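(* Let $\psi\colon\Sigma\to\mathbb{R}^{3}$ be a weakly complete improper affine front. If its Lagrangian Gauss map $\nu\colon\Sigma\to\mathbb{C}\cup\{\infty\}$ is constant, then $\psi$ is an elliptic paraboloid.
   Context: Improper affine fronts. Let $\Sigma$ be a connected oriented two-manifold. Equip $\mathbb{C}^{2}=\mathbb{R}^2+\sqrt{-1}\,\mathbb{R}^2$, with coordinates $\zeta=(\zeta_1,\zeta_2)=x+\sqrt{-1}\,n$ ($x,n\in\mathbb{R}^{2}$), with the standard metric, the symplectic form $\omega'=\frac{\sqrt{-1}}{2}(d\zeta_1\wedge d\bar\zeta_1+d\zeta_2\wedge d\bar\zeta_2)$ and $\Omega'=d\zeta_1\wedge d\zeta_2$. A special Lagrangian immersion $L\colon\Sigma\to\mathbb{C}^2$ (with respect to the calibration $\mathrm{Re}(\sqrt{-1}\,\Omega')$) is an immersion with $L^*\omega'\equiv0$ and $L^*\mathrm{Im}(\sqrt{-1}\,\Omega')\equiv 0$ (oriented so that $L^*\mathrm{Re}(\sqrt{-1}\,\Omega')>0$). A map $\psi=(x,\varphi)\colon\Sigma\to\mathbb{R}^{3}=\mathbb{R}^2\times\mathbb{R}$ is an improper affine front if there is a special Lagrangian immersion $L_\psi=x+\sqrt{-1}\,n\colon\Sigma\to\mathbb{C}^2$ such that $\varphi=-\int\langle n,dx\rangle$ (so this integral must be well defined on $\Sigma$), with $\langle\cdot,\cdot\rangle$ the standard inner product of $\mathbb{R}^2$. Let $d\tau^2=\langle dx,dx\rangle+\langle dn,dn\rangle$ be the metric induced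 by $L_\psi$. $\Sigma$ is regarded as a Riemann surface with the conformal structure of $d\tau^2$. Identifying $\mathbb{R}^2$ with $\mathbb{C}$, the functions $F$, $G$ on $\Sigma$ defined by $x=G+\bar F$, $n=\bar F-G$ are holomorphic, $(F,G)\colon\Sigma\to\mathbb{C}^2$ is a regular curve, called the Weierstrass data of $\psi$, and $d\tau^2=2(|dF|^2+|dG|^2)$. The Lagrangian Gauss map of $\psi$ is the meromorphic function $\nu=dF/dG\colon\Sigma\to\mathbb{C}\cup\{\infty\}$ (with $\nu\equiv\infty$ if $dG\equiv0$). Weak completeness. $\psi$ is weakly complete if $d\tau^2$ is a complete Riemannian metric on $\Sigma$. Elliptic paraboloids. In this statement, an elliptic paraboloid is an improper affine front which, up to a biholomorphism of the domain and an affine transformation of $\mathbb{R}^3$, is the one with $\Sigma=\mathbb{C}$ and Weierstrass data $(F,G)=(cz,z)$ for a constant $c\in\mathbb{C}$, i.e. $\psi(z)=\left(z+\bar c\bar z,\ \tfrac12(1-|c|^2)|z|^2\right)$. The case $|c|=1$, in which the image degenerates to a line, is included. *)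

(* Defs.v *)
From HB Require Import structures.
From mathcomp Require Import all_boot all_order all_algebra.
From mathcomp Require Import complex.
From mathcomp Require Import all_classical all_reals all_analysis.

Set Implicit Arguments.
Unset Strict Implicit.
Unset Printing Implicit Defensive.
Import Order.TTheory GRing.Theory Num.Theory.
Import numFieldNormedType.Exports.
Local Open Scope classical_set_scope.
Local Open Scope ring_scope.
Local Open Scope complex_scope.

Section Calculus.
Context {R : realType}.

(* [U] is always open where this is used. *)
Fixpoint Ck_on (V W : normedModType R) (k : nat) (U : set V) (f : V -> W) : Prop :=
  match k with
  | 0%N => forall y, U y -> {for y, continuous f}
  | k'.+1 => (forall y, U y -> differentiable f y) /\
             (forall v : V, Ck_on k' U ('D_v f))
  end.

Definition smooth_on (V W : normedModType R) (U : set V) (f : V -> W) : Prop :=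
  forall k, Ck_on k U f.

Definition dot2 (u v : R * R) : R := u.1 * v.1 + u.2 * v.2.

Definition det2 (u v : R * R) : R := u.1 * v.2 - u.2 * v.1.

Definition jacobian2 (f : R * R -> R * R) (y : R * R) : R :=
  det2 ('d f y (1, 0)) ('d f y (0, 1)).

Definition toC (y : R * R) : R[i] := y.1 +i* y.2.

Definition ofC (z : R[i]) : R * R := (complex.Re z, complex.Im z).

End Calculus.

(* A chart is a homeomorphism from the open set [chart_dom] onto the open set
   [chart_img]; the values of [chart_map] and [chart_inv] elsewhere are junk. *)
Record chart (R : realType) (T : topologicalType) := Chart {
  chart_dom : set T;
  chart_map : T -> R * R;
  chart_inv : R * R -> T;
  chart_dom_open : open chart_dom;
  chart_img_open : open (chart_map @` chart_dom);
  chart_mapK : forall p, chart_dom p -> chart_inv (chart_map p) = p;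
  chart_map_continuous : forall p, chart_dom p -> {for p, continuous chart_map};
  chart_inv_continuous : forall y, (chart_map @` chart_dom) y ->
    {for y, continuous chart_inv}
}.

Definition chart_img (R : realType) (T : topologicalType) (a : chart R T) :
  set (R * R) := chart_map a @` chart_dom a.

(* Smooth oriented surfaces: the atlas is smooth and all its transition maps
   preserve the orientation of the plane.  Non-emptiness is a separate field
   because [connected] holds of the empty set. *)
Record orientedSurface (R : realType) := OrientedSurface {
  surface_points :> topologicalType;
  surface_nonempty : [set: surface_points] !=set0;
  surface_hausdorff : hausdorff_space surface_points;
  surface_second_countable : @second_countable surface_points;
  surface_connected : connected [set: surface_points];
  atlas : set (chart R surface_points);
  atlas_cover : forall p, exists a, atlas a /\ chart_dom a p;
  atlas_smooth : forall a b, atlas a -> atlas b ->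
    smooth_on (chart_map a @` (chart_dom a `&` chart_dom b))
              (chart_map b \o chart_inv a);
  atlas_oriented : forall a b, atlas a -> atlas b ->
    forall p, chart_dom a p -> chart_dom b p ->
    0 < jacobian2 (chart_map b \o chart_inv a) (chart_map a p)
}.

Section SurfaceCalculus.
Context {R : realType} (S : orientedSurface R).

Definition chart_at (p : S) : chart R S := projT1 (cid (atlas_cover p)).

Definition smooth_fun (W : normedModType R) (f : S -> W) : Prop :=
  forall a, atlas a -> smooth_on (chart_img a) (f \o chart_inv a).

(* The tangent space at [p] is identified with the plane through [chart_at p];
   since the atlas is oriented, its standard basis is positively oriented. *)
Definition tdiff (W : normedModType R) (f : S -> W) (p : S) : R * R -> W :=
  'd (f \o chart_inv (chart_at p)) (chart_map (chart_at p) p).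

Definition smooth_cfun (f : S -> R[i]) : Prop := smooth_fun (ofC \o f).

Definition ctdiff (f : S -> R[i]) (p : S) (v : R * R) : R[i] :=
  toC (tdiff (ofC \o f) p v).

Definition smooth_param (h : R * R -> S) : Prop :=
  continuous h /\
  forall a, atlas a ->
    smooth_on [set y | chart_dom a (h y)] (chart_map a \o h).

(* C^1 on a neighbourhood of [0, 1]. *)
Definition C1_curve (gamma : R -> S) : Prop :=
  exists2 e : R, 0 < e &
    (forall t, - e < t < 1 + e -> {for t, continuous gamma}) /\
    (forall a, atlas a ->
       Ck_on 1 [set t : R | - e < t < 1 + e /\ chart_dom a (gamma t)]
             (chart_map a \o gamma)).

Definition velocity (gamma : R -> S) (t : R) : R * R :=
  derive1 (chart_map (chart_at (gamma t)) \o gamma) t.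

Definition tensor2 := S -> R * R -> R * R -> R.

Definition curve_length (g : tensor2) (gamma : R -> S) : \bar R :=
  (\int[@lebesgue_measure R]_(t in `[0%R, 1%R])
     (Num.sqrt (g (gamma t) (velocity gamma t) (velocity gamma t)))%:E)%E.

(* [joined g p q l]: some piecewise C^1 curve from p to q, given as a chain of
   C^1 pieces, has g-length l. *)
Inductive joined (g : tensor2) : S -> S -> \bar R -> Prop :=
| joined_refl p : joined g p p 0%E
| joined_step gamma q l : C1_curve gamma -> joined g (gamma 1) q l ->
    joined g (gamma 0) q (curve_length g gamma + l)%E.

Definition riem_dist (g : tensor2) (p q : S) : \bar R :=
  ereal_inf [set l | joined g p q l].

Definition complete_metric (g : tensor2) : Prop :=
  forall u : nat -> S,
    (forall e : R, 0 < e -> exists N, forall m n, (N <= m)%N -> (N <= n)%N ->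
       (riem_dist g (u m) (u n) < e%:E)%E) ->
    exists p, forall e : R, 0 < e -> exists N, forall n, (N <= n)%N ->
      (riem_dist g (u n) p < e%:E)%E.

End SurfaceCalculus.

Section SpecialLagrangian.
Context {R : realType}.

(* omega' and Omega' evaluated on two tangent vectors of C^2. *)
Definition omega' (u v : R[i] * R[i]) : R[i] :=
  'i%C / 2 * ((u.1 * conjc v.1 - v.1 * conjc u.1) +
              (u.2 * conjc v.2 - v.2 * conjc u.2)).

Definition Omega' (u v : R[i] * R[i]) : R[i] := u.1 * v.2 - v.1 * u.2.

Context (S : orientedSurface R).

Definition ctdiff2 (L : S -> R[i] * R[i]) (p : S) (v : R * R) : R[i] * R[i] :=
  (ctdiff (fun q => (L q).1) p v, ctdiff (fun q => (L q).2) p v).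

Definition immersion2 (L : S -> R[i] * R[i]) : Prop :=
  [/\ smooth_cfun (fun q => (L q).1), smooth_cfun (fun q => (L q).2) &
      forall p v, ctdiff2 L p v = 0 -> v = 0].

Definition special_lagrangian_immersion (L : S -> R[i] * R[i]) : Prop :=
  [/\ immersion2 L,
      forall p u v, omega' (ctdiff2 L p u) (ctdiff2 L p v) = 0,
      forall p u v,
        complex.Im ('i%C * Omega' (ctdiff2 L p u) (ctdiff2 L p v)) = 0 &
      forall p,
        0 < complex.Re ('i%C * Omega' (ctdiff2 L p (1, 0)) (ctdiff2 L p (0, 1)))].

Definition re2 (z : R[i] * R[i]) : R * R := (complex.Re z.1, complex.Re z.2).

Definition im2 (z : R[i] * R[i]) : R * R := (complex.Im z.1, complex.Im z.2).

(* psi = (x, phi) together with L_psi = x + i n; phi = - \int <n, dx> says that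
   phi is a primitive on all of S of the one-form - <n, dx>. *)
Record improper_affine_front := ImproperAffineFront {
  front_map :> S -> R * R * R;
  front_lift : S -> R[i] * R[i];
  front_lift_slag : special_lagrangian_immersion front_lift;
  front_x : forall p, (front_map p).1 = re2 (front_lift p);
  front_phi_smooth : smooth_fun (fun p => (front_map p).2);
  front_phi : forall p v,
    tdiff (fun q => (front_map q).2) p v =
    - dot2 (im2 (front_lift p)) (tdiff (fun q => (front_map q).1) p v)
}.

Context (psi : improper_affine_front).

Definition fx (p : S) : R * R := re2 (front_lift psi p).

Definition fn (p : S) : R * R := im2 (front_lift psi p).

Definition dtau2 : tensor2 S := fun p u v =>
  dot2 (tdiff fx p u) (tdiff fx p v) + dot2 (tdiff fn p u) (tdiff fn p v).

Definition weakly_complete : Prop := complete_metric dtau2.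

(* The solution of x = G + conj F, n = conj F - G. *)
Definition weierF (p : S) : R[i] := conjc ((toC (fx p) + toC (fn p)) / 2).

Definition weierG (p : S) : R[i] := (toC (fx p) - toC (fn p)) / 2.

(* The value None is the point at infinity.  dF and dG have no common zero, so
   the meromorphic function dF/dG is infinite exactly at the zeros of dG;
   elsewhere it is the scalar l with dF = l dG, which exists because F and G
   are holomorphic for the conformal structure of dtau2. *)
Definition lagrangian_gauss_map (p : S) : option R[i] :=
  if `[< forall v, ctdiff weierG p v = 0 >] then None
  else Some (xget 0 [set l | forall v,
                       ctdiff weierF p v = l * ctdiff weierG p v]).

(* Biholomorphism from S, with the conformal structure of dtau2 and its
   orientation, onto the complex line: an orientation-preserving conformal
   diffeomorphism. *)
Definition biholomorphic_to_C (k : S -> R[i]) : Prop :=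
  [/\ smooth_cfun k,
      exists h : R[i] -> S,
        [/\ cancel k h, cancel h k & smooth_param (h \o toC)],
      forall p, exists2 lambda : R, 0 < lambda &
        forall u v, dot2 (ofC (ctdiff k p u)) (ofC (ctdiff k p v)) =
                    lambda * dtau2 p u v &
      forall p, 0 < det2 (ofC (ctdiff k p (1, 0))) (ofC (ctdiff k p (0, 1)))].

(* The front on C with Weierstrass data (c z, z). *)
Definition model_paraboloid (c z : R[i]) : R * R * R :=
  (ofC (z + conjc c * conjc z),
   2^-1 * (1 - ComplexField.Normc.normc c ^+ 2) *
     ComplexField.Normc.normc z ^+ 2).

Definition elliptic_paraboloid : Prop :=
  exists (c : R[i]) (k : S -> R[i])
         (A : {linear (R * R * R)%type -> (R * R * R)%type}) (b : R * R * R),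
    [/\ biholomorphic_to_C k, bijective A &
        forall p, psi p = A (model_paraboloid c (k p)) + b].

End SpecialLagrangian.

(* Main.v *)
Require Import Defs.
From HB Require Import structures.
From mathcomp Require Import all_boot all_order all_algebra.
From mathcomp Require Import complex.
From mathcomp Require Import all_classical all_reals all_analysis.
From mathcomp Require Import measurable_realfun.
From mathcomp Require Import ring lra.

(** Write x = G + conj F and n = conj F - G.  The special Lagrangian equations say
    that dG /\ dF = 0, and the orientation says that det dG + det dF > 0, so if
    nu = dF/dG is a constant c then K := G (or K := F when nu is infinite) is a local
    diffeomorphism onto the plane along which dtau^2 is 2 (1 + |c|^2) times the
    Euclidean metric.

    A complete metric forces such a local homothety to be a global diffeomorphism.
    Say that (p, r) is good when K has a continuous section through p on the ball of
    radius r about K p.  If all (h z, r/2) are good for a section h on the ball of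
    radius r/2, the sections through the h z glue and (p, r) is good.  Hence from a
    bad pair one obtains bad pairs (p_n, r / 2^n) with d(p_n, p_{n+1}) = O(r / 2^n);
    the limit of this Cauchy sequence has a section on some ball, which contains the
    p_n and makes them good.  So sections exist on all balls, and connectedness of
    the surface makes the resulting global section inverse to K.

    In the global chart K the data F and G are affine, and integrating -<n, dx> along
    segments gives the height as a quadratic polynomial. *)

Set Implicit Arguments.
Unset Strict Implicit.
Unset Printing Implicit Defensive.
Import Order.TTheory GRing.Theory Num.Theory.
Import numFieldNormedType.Exports.
Local Open Scope classical_set_scope.
Local Open Scope ring_scope.

(** * Differentials *)

Section Differentials.
Context {R : realType}.
Implicit Types V W : normedModType R.

(** The little-o characterisation unfolded to an epsilon bound. [diff_unique] then identifies [df]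
    with the differential, so differentials can be found by estimates. *)
Lemma is_diff_eps V W (f : V -> W) (x : V) (df : {linear V -> W}) :
  continuous df ->
  (forall e : R, 0 < e ->
    \forall h \near 0, `|f (h + x) - f x - df h| <= e * `|h|) ->
  is_diff x f df.
Proof.
move=> cdf fo.
have E : f \o shift x = cst (f x) + df +o_ 0 id.
  apply/eqaddoP => e e0; near=> h.
  rewrite /= !fctE /= opprD addrA.
  by near: h; exact: fo.
have dE := diff_unique cdf E.
split => //; apply/diff_locallyP; rewrite dE; split => //.
Unshelve. all: by end_near. Qed.

Lemma differentiable_eps V W (f : V -> W) (x : V) :
  differentiable f x -> forall e : R, 0 < e ->
    \forall h \near 0, `|f (h + x) - f x - 'd f x h| <= e * `|h|.
Proof.
move=> /diff_locally /eqaddoP fo e e0.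
have := fo e e0; apply: filterS => h.
by rewrite !fctE /= opprD addrA.
Qed.

Lemma near_eq_is_diff V W (f g df : V -> W) (x : V) :
  {near x, f =1 g} -> is_diff x f df -> is_diff x g df.
Proof.
move=> fg [dfx <-].
apply: is_diff_eps; first exact: diff_continuous.
move=> e e0; have := differentiable_eps dfx e0.
apply: filterS2; last first.
  have : \forall h \near (0:V), f (h + x) = g (h + x).
    by have := fg; rewrite [X in X -> _](near_shift 0 x) subr0.
  exact: id.
by move=> h /= ->; rewrite (nbhs_singleton fg).
Qed.

Lemma near_eq_differentiable V W (f g : V -> W) (x : V) :
  {near x, f =1 g} -> differentiable f x -> differentiable g x.
Proof. by move=> fg /differentiableP /(near_eq_is_diff fg) []. Qed.

Lemma open_near_eq (V : topologicalType) (W : Type) (U : set V) (f g : V -> W) (y : V) :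
  open U -> U y -> {in U, f =1 g} -> {near y, f =1 g}.
Proof.
move=> oU Uy fg; near=> z; apply: fg; rewrite inE.
by near: z; exact: open_nbhs_nbhs.
Unshelve. all: by end_near. Qed.

Lemma fst_continuous (V W : topologicalType) : continuous (@fst V W).
Proof. by move=> p; exact: cvg_fst. Qed.

Lemma snd_continuous (V W : topologicalType) : continuous (@snd V W).
Proof. by move=> p; exact: cvg_snd. Qed.

End Differentials.

(** * Calculus of C^k maps *)

Section CkCalculus.
Context {R : realType}.
Implicit Types V W : normedModType R.

(** Openness turns agreement on [U] into agreement near each of its points, hence of directional
    derivatives too. The closure lemmas below use this to replace a derivative by its formula. *)
Lemma Ck_on_ext V W k (U : set V) (f g : V -> W) : open U ->
  {in U, f =1 g} -> Ck_on k U f -> Ck_on k U g.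
Proof.
move=> oU; elim: k f g => [|k IH] f g fg /=.
  move=> cf y Uy.
  have fgy : f y = g y by apply: fg; rewrite inE.
  suff : g @ y --> g y by [].
  rewrite -fgy.
  apply: cvg_trans (cf y Uy); apply: near_eq_cvg.
  exact: open_near_eq fg.
move=> [df Df]; split.
  move=> y Uy; apply: near_eq_differentiable (df y Uy).
  exact: open_near_eq fg.
move=> v; apply: IH (Df v) => y; rewrite inE => Uy.
by apply: near_eq_derive; exact: open_near_eq fg.
Qed.

Lemma Ck_on_sub V W k (U U' : set V) (f : V -> W) :
  U' `<=` U -> Ck_on k U f -> Ck_on k U' f.
Proof.
move=> U'U; elim: k f => [|k IH] f /=; first by move=> cf y /U'U /cf.
by move=> [df Df]; split => [y /U'U /df //|v]; exact: IH.
Qed.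

Lemma Ck_onW V W k (U : set V) (f : V -> W) : Ck_on k.+1 U f -> Ck_on k U f.
Proof.
elim: k f => [|k IH] f.
  by move=> [df _] y Uy; apply: differentiable_continuous; exact: df.
by move=> [df Df]; split => // v; apply: IH; exact: Df.
Qed.

Lemma Ck_on_diff V W k (U : set V) (f : V -> W) y :
  Ck_on k.+1 U f -> U y -> differentiable f y.
Proof. by move=> [df _]; exact: df. Qed.

Lemma Ck_on_derive V W k (U : set V) (f : V -> W) v :
  Ck_on k.+1 U f -> Ck_on k U ('D_v f).
Proof. by move=> [_]; apply. Qed.

Lemma Ck_on_continuous V W k (U : set V) (f : V -> W) y :
  Ck_on k U f -> U y -> {for y, continuous f}.
Proof.
by elim: k => [|k IH]; [apply|move=> /Ck_onW].
Qed.

Lemma Ck_on_cst V W k (U : set V) (a : W) : Ck_on k U (cst a : V -> W).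
Proof.
elim: k a => [|k IH] a /=; first by move=> y _; exact: cst_continuous.
split=> [y _|v]; first exact: differentiable_cst.
suff -> : 'D_v (cst a : V -> W) = cst 0 by exact: IH.
by apply/funext => y; rewrite derive_cst.
Qed.

Lemma Ck_on_linear V W W' k (U : set V) (f : V -> W) (A : {linear W -> W'}) :
  open U -> continuous A -> Ck_on k U f -> Ck_on k U (A \o f).
Proof.
move=> oU cA; elim: k f => [|k IH] f /=.
  by move=> cf y Uy; apply: continuous_comp; [exact: cf|exact: cA].
move=> [df Df]; split.
  move=> y Uy; apply: differentiable_comp; first exact: df.
  exact: linear_differentiable.
move=> v; apply: Ck_on_ext (IH _ (Df v)) => // y; rewrite inE => Uy /=.
have dfy := df y Uy.
have dA : differentiable A (f y) by exact: linear_differentiable.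
rewrite !deriveE//; last exact: differentiable_comp.
by rewrite (diff_comp dfy dA) /= diff_lin.
Qed.

Lemma Ck_on_pair V W W' k (U : set V) (f : V -> W) (g : V -> W') :
  open U -> Ck_on k U f -> Ck_on k U g -> Ck_on k U (fun y => (f y, g y)).
Proof.
move=> oU; elim: k f g => [|k IH] f g /=.
  by move=> cf cg y Uy; apply: cvg_pair; [exact: cf|exact: cg].
move=> [df Df] [dg Dg]; split.
  by move=> y Uy; apply: differentiable_pair; [exact: df|exact: dg].
move=> v; apply: Ck_on_ext (IH _ _ (Df v) (Dg v)) => // y; rewrite inE => Uy /=.
have dfy := df y Uy; have dgy := dg y Uy.
rewrite !deriveE//; last exact: differentiable_pair.
by rewrite diff_pair.
Qed.

Lemma Ck_on_fst V W W' k (U : set V) (f : V -> W * W') :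
  open U -> Ck_on k U f -> Ck_on k U (fun y => (f y).1).
Proof.
move=> oU; apply: (Ck_on_linear (A := (fst : {linear (W * W')%type -> W}))) => //.
exact: fst_continuous.
Qed.

Lemma Ck_on_snd V W W' k (U : set V) (f : V -> W * W') :
  open U -> Ck_on k U f -> Ck_on k U (fun y => (f y).2).
Proof.
move=> oU; apply: (Ck_on_linear (A := (snd : {linear (W * W')%type -> W'}))) => //.
exact: snd_continuous.
Qed.

Lemma Ck_onD V W k (U : set V) (f g : V -> W) :
  open U -> Ck_on k U f -> Ck_on k U g -> Ck_on k U (fun y => f y + g y).
Proof.
move=> oU; elim: k f g => [|k IH] f g /=.
  by move=> cf cg y Uy; apply: cvgD; [exact: cf|exact: cg].
move=> [df Df] [dg Dg]; split.
  by move=> y Uy; apply: differentiableD; [exact: df|exact: dg].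
move=> v; apply: Ck_on_ext (IH _ _ (Df v) (Dg v)) => // y; rewrite inE => Uy /=.
by rewrite [RHS]deriveD //; apply: diff_derivable; [exact: df|exact: dg].
Qed.

Lemma Ck_onZ V W k (U : set V) (f : V -> W) (a : R) :
  open U -> Ck_on k U f -> Ck_on k U (fun y => a *: f y).
Proof.
move=> oU; apply: (Ck_on_linear (A := ( *:%R a : {linear W -> W}))) => //.
exact: scaler_continuous.
Qed.

(** The Leibniz rule contains [f] and [g] undifferentiated, which is why the induction lowers their
    order with [Ck_onW]. *)
Lemma Ck_onM V k (U : set V) (f g : V -> R) :
  open U -> Ck_on k U f -> Ck_on k U g -> Ck_on k U (fun y => f y * g y).
Proof.
move=> oU; elim: k f g => [|k IH] f g.
  by move=> cf cg y Uy; apply: cvgM; [exact: cf|exact: cg].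
move=> Cf Cg; have [df Df] := Cf; have [dg Dg] := Cg; split.
  by move=> y Uy; apply: differentiableM; [exact: df|exact: dg].
move=> v.
apply: Ck_on_ext (Ck_onD oU (IH _ _ (Ck_onW Cf) (Dg v))
                            (IH _ _ (Ck_onW Cg) (Df v))) => //.
move=> y; rewrite inE => Uy /=.
by rewrite [RHS]deriveM //; apply: diff_derivable; [exact: df|exact: dg].
Qed.

Lemma Ck_onV V k (U : set V) (f : V -> R) :
  open U -> (forall y, U y -> f y != 0) ->
  Ck_on k U f -> Ck_on k U (fun y => (f y)^-1).
Proof.
move=> oU f0; elim: k => [|k IH].
  by move=> cf y Uy; apply: cvgV; [exact: f0|exact: cf].
move=> Cf; have [df Df] := Cf; split.
  by move=> y Uy; apply: differentiableV; [exact: df|exact: f0].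
move=> v.
have IHf := IH (Ck_onW Cf).
apply: Ck_on_ext (Ck_onZ (-1) oU (Ck_onM oU (Ck_onM oU IHf IHf) (Df v))) => //.
move=> y; rewrite inE => Uy /=.
rewrite [RHS]deriveV; [|exact: f0|by apply: diff_derivable; exact: df].
by rewrite scaleN1r scaleNr -expr2 exprVn.
Qed.


Lemma pair_basis (w : R * R) : w = w.1 *: (1, 0) + w.2 *: (0, 1) :> R * R.
Proof.
case: w => a b; apply/pair_equal_spec; split => /=.
  by rewrite /GRing.scale /= mulr1 mulr0 addr0.
by rewrite /GRing.scale /= mulr1 mulr0 add0r.
Qed.

Lemma derive_comp2 V (f : V -> R * R) (g : R * R -> R) y v :
  differentiable f y -> differentiable g (f y) ->
  'D_v (g \o f) y = ('D_v f y).1 * 'D_(1, 0) g (f y) +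
                    ('D_v f y).2 * 'D_(0, 1) g (f y).
Proof.
move=> df dg; rewrite !deriveE//; last exact: differentiable_comp.
by rewrite (diff_comp df dg) /= {1}[X in 'd g (f y) X]pair_basis linearD !linearZ.
Qed.

(** In partial derivatives the chain rule is a sum of products of real functions, so the induction
    closes with [Ck_onM] and [Ck_onD]. *)
Lemma Ck_on_comp_real V k (U : set V) (U' : set (R * R)) (f : V -> R * R)
    (g : R * R -> R) :
  open U -> (forall y, U y -> U' (f y)) ->
  Ck_on k U f -> Ck_on k U' g -> Ck_on k U (g \o f).
Proof.
move=> oU fU; elim: k g => [|k IH] g.
  move=> cf cg y Uy; apply: continuous_comp; first exact: cf.
  by apply: cg; exact: fU.
move=> Cf Cg; have [df Df] := Cf; have [dg Dg] := Cg; split.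
  by move=> y Uy; apply: differentiable_comp; [exact: df|exact/dg/fU].
move=> v; have {}IH := IH _ (Ck_onW Cf) (Dg _).
have C1 := Ck_onM oU (Ck_on_fst oU (Df v)) (IH (1, 0)).
have C2 := Ck_onM oU (Ck_on_snd oU (Df v)) (IH (0, 1)).
apply: Ck_on_ext (Ck_onD oU C1 C2) => // y; rewrite inE => Uy /=.
by rewrite derive_comp2//; [exact: df|exact/dg/fU].
Qed.

Lemma Ck_on_comp V k (U : set V) (U' : set (R * R)) (f : V -> R * R)
    (g : R * R -> R * R) :
  open U -> open U' -> (forall y, U y -> U' (f y)) ->
  Ck_on k U f -> Ck_on k U' g -> Ck_on k U (g \o f).
Proof.
move=> oU oU' fU Cf Cg.
have C1 := Ck_on_comp_real oU fU Cf (Ck_on_fst oU' Cg).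
have C2 := Ck_on_comp_real oU fU Cf (Ck_on_snd oU' Cg).
apply: Ck_on_ext (Ck_on_pair oU C1 C2) => // y _ /=.
by rewrite -surjective_pairing.
Qed.

End CkCalculus.

(** * The inverse function theorem in the plane *)

Section InverseFunction.
Context {R : realType}.
Implicit Types V W : normedModType R.

Lemma near_distP V (x : V) (P : V -> Prop) :
  (\forall y \near x, P y) <->
  exists2 r : R, 0 < r & forall y, `|y - x| < r -> P y.
Proof.
split; first by move=> /nbhs_normP[r r0 rP]; exists r => // y yx; apply: rP;
  rewrite /= distrC.
by move=> [r r0 rP]; apply/nbhs_normP; exists r => // y /=; rewrite distrC; exact: rP.
Qed.

Lemma continuous_distP V W (f : V -> W) (x : V) :
  {for x, continuous f} <->
  forall e : R, 0 < e -> exists2 r : R, 0 < r &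
    forall y, `|y - x| < r -> `|f y - f x| < e.
Proof.
split.
  move=> cf e e0; apply/near_distP.
  have /cvgrPdist_lt /(_ e e0) : f @ x --> f x by exact: cf.
  by apply: filterS => y; rewrite distrC.
move=> H; suff : f @ x --> f x by [].
apply/cvgrPdist_lt => e e0.
by have /near_distP := H e e0; apply: filterS => y; rewrite distrC.
Qed.

(** Put u = h (k + y) - h y and let A be the differential of [f] at [h y]. Since [B] inverts A, u -
    B k = - B (k - A u), and k - A u is the remainder of [f], small compared with u. *)
Lemma inverse_is_diff V W (f : V -> W) (h : W -> V) (y : W) (B : {linear W -> V}) :
  continuous B -> cancel ('d f (h y)) B -> {for y, continuous h} ->
  (\forall z \near y, f (h z) = z) -> differentiable f (h y) ->
  is_diff y h B.
Proof.
move=> cB AB ch fh df.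
have [C C0 BC] := linear_lipschitz cB.
apply: is_diff_eps => // e e0.
(* The first bound allows absorption and gives |u| <= 2 C |k|; the second then makes the error at
   most e |k|. *)
pose d := Num.min (1 / (2 * C)) (e / (2 * C * C)).
have d0 : 0 < d.
  by rewrite /d lt_min !divr_gt0 //= !mulr_gt0.
have dC1 : C * d <= 1 / 2.
  have : d <= 1 / (2 * C) by rewrite /d ge_min lexx.
  by rewrite ler_pdivlMr ?mulr_gt0//; lra.
have dC2 : 2 * C * (C * d) <= e.
  have : d <= e / (2 * C * C) by rewrite /d ge_min lexx orbT.
  by rewrite ler_pdivlMr ?mulr_gt0//; lra.
have [r r0 fr] := (near_distP _ _).1 (differentiable_eps df d0).
have [r1 r10 hr1] := (continuous_distP _ _).1 ch r r0.
have [r2 r20 fhr] := (near_distP _ _).1 fh.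
apply/near_distP; exists (Num.min r1 r2); first by rewrite lt_min r10.
move=> k; rewrite subr0 lt_min => /andP[kr1 kr2].
set u := h (k + y) - h y.
have ur : `|u - 0| < r by rewrite subr0; apply: hr1; rewrite addrK.
have := fr u ur.
rewrite /u subrK fhr ?addrK // -/u.
have -> : f (h y) = y by apply: fhr; rewrite subrr normr0.
rewrite addrK => rest.
have uB : u - B k = - B (k - 'd f (h y) u).
  by rewrite linearB AB opprB.
have Br : `|u - B k| <= C * d * `|u|.
  rewrite uB normrN (le_trans (BC _))// -mulrA ler_wpM2l// ltW//.
have u2 : `|u| <= 2 * C * `|k|.
  have h1 : `|u| <= `|u - B k| + `|B k|.
    by rewrite -{1}(subrK (B k) u) ler_normD.
  have h2 := BC k.
  have h3 : C * d * `|u| <= 1 / 2 * `|u| by rewrite ler_wpM2r.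
  lra.
rewrite (le_trans Br)//.
apply: (@le_trans _ _ (C * d * (2 * C * `|k|))).
  by rewrite ler_wpM2l// ltW// mulr_gt0.
have -> : C * d * (2 * C * `|k|) = 2 * C * (C * d) * `|k| by ring.
by rewrite ler_wpM2r.
Qed.

(** Cramer's rule for the matrix with columns [a] and [b]. *)
Definition inv2 (a b w : R * R) : R * R :=
  (det2 w b / det2 a b, det2 a w / det2 a b).

Lemma inv2_linear a b : linear (inv2 a b).
Proof.
move=> c [u1 u2] [v1 v2]; apply/pair_equal_spec; rewrite /det2; split => /=.
  by rewrite -![_ *: (_ : R)]/(_ * _) /det2 /=; ring.
by rewrite -![_ *: (_ : R)]/(_ * _) /det2 /=; ring.
Qed.

HB.instance Definition _ a b :=
  GRing.isLinear.Build R (R * R)%type (R * R)%type *:%R (inv2 a b) (inv2_linear a b).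

Lemma inv2_continuous a b : continuous (inv2 a b).
Proof.
have c1 := @fst_continuous R R; have c2 := @snd_continuous R R.
have lin (p q : R) : continuous (fun w : R * R => w.1 * p + w.2 * q).
  move=> w; apply: (@cvgD _ _ _ _ _ (fun w : R * R => w.1 * p) (fun w => w.2 * q)).
    by apply: (@cvgMr_tmp _ _ _ _ fst) => //; exact: c1.
  by apply: (@cvgMr_tmp _ _ _ _ snd) => //; exact: c2.
have -> : inv2 a b = (fun w => (w.1 * (b.2 / det2 a b) + w.2 * (- b.1 / det2 a b),
                     w.1 * (- a.2 / det2 a b) + w.2 * (a.1 / det2 a b))).
  by apply/funext => w; rewrite /inv2 {1 3}/det2; apply/pair_equal_spec; split; ring.
move=> w; exact: (cvg_pair (lin _ _ w) (lin _ _ w)).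
Qed.

Lemma inv2K (A : {linear (R * R)%type -> (R * R)%type}) :
  det2 (A (1, 0)) (A (0, 1)) != 0 ->
  cancel A (inv2 (A (1, 0)) (A (0, 1))).
Proof.
move=> D0 w; rewrite [in A w](pair_basis w) linearD !linearZ /=.
move: (A (1, 0)) (A (0, 1)) D0 => [a1 a2] [b1 b2]; case: w => x y.
rewrite /inv2 /det2 /= -![_ *: (_ : R)]/(_ * _) => D0.
by apply/pair_equal_spec; split; field.
Qed.

Lemma inv2KV (A : {linear (R * R)%type -> (R * R)%type}) :
  det2 (A (1, 0)) (A (0, 1)) != 0 ->
  cancel (inv2 (A (1, 0)) (A (0, 1))) A.
Proof.
move=> D0 w; rewrite [X in A X]pair_basis linearD !linearZ /=.
move: (A (1, 0)) (A (0, 1)) D0 => [a1 a2] [b1 b2]; case: w => x y.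
rewrite /inv2 /det2 /= => D0.
by apply/pair_equal_spec; split; rewrite /= -![_ *: (_ : R)]/(_ * _); field.
Qed.

Lemma ball_segment V (c x x' : V) (r t : R) :
  `|x - c| < r -> `|x' - c| < r -> 0 <= t <= 1 ->
  `|x' + t *: (x - x') - c| < r.
Proof.
move=> xr x'r /andP[t0 t1].
have -> : x' + t *: (x - x') - c = t *: (x - c) + (1 - t) *: (x' - c).
  have -> : x - x' = (x - c) - (x' - c) by rewrite opprB addrA subrK.
  by rewrite scalerBr scalerBl scale1r addrAC addrCA.
rewrite (le_lt_trans (ler_normD _ _))// !normrZ ger0_norm// ger0_norm ?subr_ge0//.
have [t10|t1n] := eqVneq t 0; first by rewrite t10 mul0r add0r subr0 mul1r.
have tp : 0 < t by rewrite lt_def t1n.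
have h1 : t * `|x - c| < t * r by rewrite ltr_pM2l.
have h2 : (1 - t) * `|x' - c| <= (1 - t) * r.
  by rewrite ler_wpM2l ?subr_ge0// ltW.
lra.
Qed.

Lemma is_derive_segment V W (f : V -> W) (x v : V) (t : R) :
  differentiable f (x + t *: v) ->
  is_derive t 1 (fun s : R => f (x + s *: v)) ('D_v f (x + t *: v)).
Proof.
move=> df.
have dg : is_diff t (fun s : R => x + s *: v) (fun s : R => s *: v).
  have : is_diff t (cst x + ( *:%R^~ v)) (0 + ( *:%R^~ v)) by apply: is_diffD.
  by rewrite add0r.
have dc : is_diff t (f \o (fun s : R => x + s *: v))
    ('d f (x + t *: v) \o (fun s : R => s *: v)).
  by apply: is_diff_comp; exact: differentiableP.
split; first by apply: diff_derivable; exact: ex_diff.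
by rewrite !deriveE// ?diff_val /= ?scale1r //; exact: ex_diff.
Qed.

Lemma mean_value_segment V (f : V -> R) (x x' : V) :
  (forall t : R, 0 <= t <= 1 -> differentiable f (x' + t *: (x - x'))) ->
  exists2 t : R, 0 <= t <= 1 & f x - f x' = 'D_(x - x') f (x' + t *: (x - x')).
Proof.
move=> df.
pose g s := f (x' + s *: (x - x')).
have dg (t : R) : 0 <= t <= 1 -> is_derive t 1 g ('D_(x - x') f (x' + t *: (x - x'))).
  by move=> t01; apply: is_derive_segment; exact: df.
have [||c c01] := @MVT_segment R g
    (fun t => 'D_(x - x') f (x' + t *: (x - x'))) 0 1 ler01.
- by move=> t; rewrite in_itv/= => /andP[t0 t1]; apply: dg; rewrite !ltW.
- apply: derivable_within_continuous => t; rewrite in_itv/= => t01.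
  by have [] := dg t t01.
- rewrite /g scale1r scale0r addr0 subrKC subr0 mulr1 => E.
  by exists c => //; rewrite in_itv /= in c01.
Qed.

Lemma norm_pair_le (x : R * R) (m : R) : `|x.1| <= m -> `|x.2| <= m -> `|x| <= m.
Proof. by move=> h1 h2; rewrite [`|x|]/(Num.max `|x.1| `|x.2|) ge_max h1. Qed.

Lemma norm_fst_le (x : R * R) : `|x.1| <= `|x|.
Proof. by rewrite [`|x|]/(Num.max `|x.1| `|x.2|) le_max lexx. Qed.

Lemma norm_snd_le (x : R * R) : `|x.2| <= `|x|.
Proof. by rewrite [`|x|]/(Num.max `|x.1| `|x.2|) le_max lexx orbT. Qed.

Lemma derive_pairE W (f : R * R -> W) (x w : R * R) : differentiable f x ->
  'D_w f x = w.1 *: 'D_(1, 0) f x + w.2 *: 'D_(0, 1) f x.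
Proof.
by move=> df; rewrite !deriveE// [in LHS](pair_basis w) linearD !linearZ.
Qed.

(** Mean value theorem along the segment. The plane carries the maximum norm, so each coordinate of
    [x - x'] is bounded by its norm, and the two partials give the factor 2. *)
Lemma lipschitz_of_partials (f : R * R -> R) (c : R * R) (r m : R) :
  (forall x, `|x - c| < r -> differentiable f x) ->
  (forall x, `|x - c| < r -> `|'D_(1, 0) f x| <= m /\ `|'D_(0, 1) f x| <= m) ->
  forall x x', `|x - c| < r -> `|x' - c| < r ->
  `|f x - f x'| <= 2 * m * `|x - x'|.
Proof.
move=> df Df x x' xr x'r.
have [t t01 ->] := mean_value_segment
  (fun t t01 => df _ (ball_segment xr x'r t01)).
set z := x' + _; have zr : `|z - c| < r by exact: ball_segment.
rewrite derive_pairE; last exact: df.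
have [D1 D2] := Df z zr.
rewrite (le_trans (ler_normD _ _))// !normrZ.
have n1 := norm_fst_le (x - x'); have n2 := norm_snd_le (x - x').
have h1 : `|(x - x').1| * `|'D_(1, 0) f z| <= `|x - x'| * m by rewrite ler_pM.
have h2 : `|(x - x').2| * `|'D_(0, 1) f z| <= `|x - x'| * m by rewrite ler_pM.
lra.
Qed.

End InverseFunction.

(** * Existence, continuity and smoothness of the local inverse *)

Section LocalInverse.
Context {R : realType}.
Implicit Types V W : normedModType R.

Lemma Ck_on_id V k (U : set V) : Ck_on k U (id : V -> V).
Proof.
case: k => [|k] /=; first by move=> y _; exact: cvg_id.
split=> [y _|v]; first exact: ex_diff.
suff -> : 'D_v (id : V -> V) = cst v by exact: Ck_on_cst.
by apply/funext => y; rewrite derive_id.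
Qed.

Lemma is_diff_linear V W (A : {linear V -> W}) x : continuous A -> is_diff x A A.
Proof. by move=> cA; split; [exact: linear_differentiable|exact: diff_lin]. Qed.

Lemma small_partials (f : R * R -> R) (U : set (R * R)) (x0 : R * R) (m : R) :
  open U -> U x0 -> Ck_on 1 U f -> is_diff x0 f 0 -> 0 < m ->
  exists2 r : R, 0 < r & forall x, `|x - x0| < r ->
    [/\ U x, `|'D_(1, 0) f x| <= m & `|'D_(0, 1) f x| <= m].
Proof.
move=> oU Ux0 Cf [df dE] m0.
have small (v : R * R) : exists2 r : R, 0 < r &
    forall x, `|x - x0| < r -> `|'D_v f x| < m.
  have D0 : 'D_v f x0 = 0 by rewrite deriveE// dE.
  have := Ck_on_continuous (Ck_on_derive v Cf) Ux0.
  by move=> /continuous_distP /(_ m m0) [r r0 Hr]; exists r => // x /Hr; rewrite D0 subr0.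
have [r1 r10 H1] := small (1, 0); have [r2 r20 H2] := small (0, 1).
have /near_distP [r3 r30 H3] : \forall x \near x0, U x by exact: open_nbhs_nbhs.
exists (Num.min r1 (Num.min r2 r3)); first by rewrite !lt_min r10 r20.
move=> x; rewrite !lt_min => /and3P[/H1 h1 /H2 h2 /H3 h3].
by split; [exact: h3|exact: (ltW h1)|exact: (ltW h2)].
Qed.

(** The map x - B (f x) has zero differential at [x0], so its partials are at most 1/4 nearby, and
    the factor 2 of [lipschitz_of_partials] makes it a contraction of ratio 1/2. *)
Lemma contraction_defect (f : R * R -> R * R) (U : set (R * R)) (x0 : R * R)
    (B : {linear (R * R)%type -> (R * R)%type}) :
  open U -> U x0 -> Ck_on 1 U f -> continuous B -> cancel ('d f x0) B ->
  exists2 r : R, 0 < r & (forall x, `|x - x0| < r -> U x) /\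
    forall x x', `|x - x0| < r -> `|x' - x0| < r ->
      `|(x - B (f x)) - (x' - B (f x'))| <= 2^-1 * `|x - x'|.
Proof.
move=> oU Ux0 Cf cB AB.
pose phi x := x + -1 *: B (f x).
have phiE x : x - B (f x) = phi x by rewrite /phi scaleN1r.
have Cphi : Ck_on 1 U phi.
  exact: (Ck_onD oU (Ck_on_id 1 U) (Ck_onZ (-1) oU (Ck_on_linear oU cB Cf))).
have df0 : differentiable f x0 := Ck_on_diff Cf Ux0.
have dphi : is_diff x0 phi 0.
  have d1 : is_diff x0 (B \o f) (B \o 'd f x0).
    by apply: is_diff_comp; [exact: differentiableP|exact: is_diff_linear].
  have : is_diff x0 (id + -1 *: (B \o f)) (id + -1 *: (B \o 'd f x0)).
    by apply: is_diffD.
  congr (is_diff_def _ _ _); apply/funext => v.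
  by rewrite [LHS]/(v + -1 *: B ('d f x0 v)) AB scaleN1r; exact: subrr.
have C1 := Ck_on_fst oU Cphi; have C2 := Ck_on_snd oU Cphi.
have c1 := @fst_continuous R R; have c2 := @snd_continuous R R.
have D1 : is_diff x0 (fun x => (phi x).1) 0.
  exact: (is_diff_comp dphi (is_diff_linear (A := (fst : {linear (R * R)%type -> R})) _ c1)).
have D2 : is_diff x0 (fun x => (phi x).2) 0.
  exact: (is_diff_comp dphi (is_diff_linear (A := (snd : {linear (R * R)%type -> R})) _ c2)).
have q0 : 0 < 4^-1 :> R by rewrite invr_gt0.
have [r1 r10 H1] := small_partials oU Ux0 C1 D1 q0.
have [r2 r20 H2] := small_partials oU Ux0 C2 D2 q0.
have lt1 x : `|x - x0| < Num.min r1 r2 -> `|x - x0| < r1.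
  by rewrite lt_min => /andP[].
have lt2 x : `|x - x0| < Num.min r1 r2 -> `|x - x0| < r2.
  by rewrite lt_min => /andP[].
exists (Num.min r1 r2); first by rewrite lt_min r10.
split; first by move=> x /lt1/H1[].
move=> x x' xr x'r; rewrite !phiE.
have two4 : 2 * 4^-1 = 2^-1 :> R by field.
apply: norm_pair_le; rewrite -two4.
  apply: (lipschitz_of_partials (f := fun x => (phi x).1) _ _ xr x'r) => z /lt1/H1[Uz p1 p2].
    exact: Ck_on_diff C1 Uz.
  exact: conj p1 p2.
apply: (lipschitz_of_partials (f := fun x => (phi x).2) _ _ xr x'r) => z /lt2/H2[Uz p1 p2].
  exact: Ck_on_diff C2 Uz.
exact: conj p1 p2.
Qed.

Lemma compact_square (c : R * R) (r : R) : compact [set x : R * R | `|x - c| <= r].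
Proof.
have -> : [set x : R * R | `|x - c| <= r] =
    `[c.1 - r, c.1 + r] `*` `[c.2 - r, c.2 + r].
  apply/seteqP; split => x; rewrite /= !in_itv /= -!ler_distl.
    move=> h; split; apply: le_trans h.
      exact: (norm_fst_le (x - c)).
    exact: (norm_snd_le (x - c)).
  by move=> [h1 h2]; exact: norm_pair_le.
by apply: compact_setX; exact: segment_compact.
Qed.

(** Triangle inequality, absorbing half of |x - x'|. With y = q x, a map differing from the identity
    by a contraction of ratio 1/2 shrinks distances at most by half; this yields injectivity and the
    continuity of the inverse. *)
Lemma expansion_of_defect V (x x' y y' : V) :
  `|(x - y) - (x' - y')| <= 2^-1 * `|x - x'| -> `|x - x'| <= 2 * `|y - y'|.
Proof.
have : `|x - x'| <= `|(x - y) - (x' - y')| + `|y - y'|.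
  apply: le_trans (ler_normD _ _).
  suff -> : x - y - (x' - y') + (y - y') = x - x' by [].
  by rewrite opprB addrACA subrK addrAC subrr add0r.
lra.
Qed.

(* [x |-> |w - q x|] attains its minimum on a small closed square; if the minimum
   at [x] were positive, moving to [x + (w - q x)] would at least halve it. *)
Lemma perturbed_id_surjective (q : R * R -> R * R) (x0 w : R * R) (r d : R) :
  0 < d -> 5 * d < r ->
  (forall x, `|x - x0| < r -> {for x, continuous q}) ->
  (forall x x', `|x - x0| < r -> `|x' - x0| < r ->
      `|(x - q x) - (x' - q x')| <= 2^-1 * `|x - x'|) ->
  `|w - q x0| <= d -> exists2 x, `|x - x0| < r & q x = w.
Proof.
move=> d0 dr cq qc wd.
(* The minimiser lies within 4 d of [x0] and the correction moves it by at most d, so radius 5 d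
   keeps the corrected point in the square. *)
pose A := [set x : R * R | `|x - x0| <= 5 * d].
have Ar x : A x -> `|x - x0| < r by move=> /le_lt_trans; apply.
have Ax0 : A x0 by rewrite /A /= subrr normr0 mulr_ge0// ltW.
have cA : compact A by exact: compact_square.
have [||c + cmin] := @compact_EVT_min _ R (fun x => `|w - q x|) A _ cA.
- by exists x0.
- apply: continuous_in_subspaceT => x; rewrite inE => /Ar xr.
  have c1 : q @ x --> q x by exact: cq.
  by apply: cvg_norm; apply: cvgB => //; exact: cvg_cst.
rewrite inE => Ac; have cr := Ar _ Ac.
exists c => //; apply/esym/eqP; rewrite -subr_eq0 -normr_le0.
set m := `|w - q c|.
have x0r : `|x0 - x0| < r by exact: Ar.
have md : m <= d by apply: le_trans wd; apply: cmin; rewrite inE.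
have lip x x' : `|x - x0| < r -> `|x' - x0| < r -> `|x - x'| <= 2 * `|q x - q x'|.
  by move=> xr x'r; apply: expansion_of_defect; exact: qc.
have cx0 : `|c - x0| <= 4 * d.
  apply: le_trans (lip _ _ cr x0r) _.
  have : `|q c - q x0| <= `|q c - w| + `|w - q x0| by exact: ler_distD.
  rewrite (distrC (q c) w) -/m; lra.
pose c' := c + (w - q c).
have Ac' : A c'.
  rewrite /A /c' /= addrAC (le_trans (ler_normD _ _))// -/m; lra.
have := qc c' c (Ar _ Ac') cr.
have -> : c' - c = w - q c by rewrite /c' addrC addKr.
have -> : c' - q c' - (c - q c) = w - q c'.
  by rewrite /c'; apply/pair_equal_spec; split; rewrite /=; ring.
rewrite -/m; have : m <= `|w - q c'| by apply: cmin; rewrite inE.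
lra.
Qed.

(** Composed with the inverse [B] of its differential, [f] becomes a perturbation [q] of the
    identity, to which [perturbed_id_surjective] and [expansion_of_defect] apply; injectivity of [B]
    transfers the solutions back to [f]. *)
Lemma local_inverse (f : R * R -> R * R) (U : set (R * R)) (x0 : R * R) :
  open U -> U x0 -> Ck_on 1 U f -> jacobian2 f x0 != 0 ->
  exists r d (h : R * R -> R * R), [/\ 0 < r, 0 < d,
    forall x, `|x - x0| < r -> U x,
    forall x x', `|x - x0| < r -> `|x' - x0| < r -> f x = f x' -> x = x' &
    forall z, `|z - f x0| < d ->
      [/\ `|h z - x0| < r, f (h z) = z & {for z, continuous h}]].
Proof.
move=> oU Ux0 Cf J0.
pose B : {linear (R * R)%type -> (R * R)%type} := inv2 ('d f x0 (1, 0)) ('d f x0 (0, 1)).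
have cB : continuous B by exact: inv2_continuous.
have AB : cancel ('d f x0) B by exact: inv2K.
have BA : cancel B ('d f x0) by exact: inv2KV.
have [r r0 [rU rc]] := contraction_defect oU Ux0 Cf cB AB.
have [C C0 BC] := linear_lipschitz cB.
pose q := B \o f.
have lip x x' : `|x - x0| < r -> `|x' - x0| < r -> `|x - x'| <= 2 * `|q x - q x'|.
  by move=> xr x'r; apply: expansion_of_defect; exact: rc.
(* With this [d] the target [B z] is within r / 6 of [q x0], and 5 (r / 6) < r. *)
pose d := r / (6 * C).
have d0 : 0 < d by rewrite divr_gt0// mulr_gt0.
have ex z : `|z - f x0| < d -> exists2 x, `|x - x0| < r & f x = z.
  move=> zd.
  have [|||||x xr qx] := @perturbed_id_surjective q x0 (B z) r (r / 6).
  - by rewrite divr_gt0.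
  - lra.
  - move=> x xr; apply: continuous_comp; last exact: cB.
    by apply: Ck_on_continuous Cf _; exact: rU.
  - exact: rc.
  - rewrite /q /= -linearB (le_trans (BC _))//.
    have : C * `|z - f x0| <= C * d by rewrite ler_wpM2l// ltW.
    by have -> : C * d = r / 6 by rewrite /d; field; rewrite gt_eqF.
  by exists x => //; apply: (can_inj BA).
(* Where no preimage exists in the ball, [x0] is a junk value. *)
pose h z := if pselect (exists2 x, `|x - x0| < r & f x = z) is left e
  then projT1 (cid2 e) else x0.
have hP z : `|z - f x0| < d -> `|h z - x0| < r /\ f (h z) = z.
  move=> /ex exz; rewrite /h; case: pselect => // e.
  by case: (cid2 e).
exists r, d, h; split => //.
  move=> x x' xr x'r fxx'; apply/eqP; rewrite -subr_eq0 -normr_le0.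
  by have := lip _ _ xr x'r; rewrite /q /= fxx' subrr normr0 mulr0.
move=> z zd; have [hr fh] := hP z zd; split => //.
apply/continuous_distP => e e0.
(* The first entry keeps [y] in the ball where [h] inverts [f]; the second makes 2 C |y - z| smaller
   than [e]. *)
exists (Num.min (d - `|z - f x0|) (e / (4 * C))).
  by rewrite lt_min subr_gt0 zd divr_gt0// mulr_gt0.
move=> y; rewrite lt_min => /andP[y1 y2].
have yd : `|y - f x0| < d.
  rewrite (le_lt_trans (ler_distD z _ _))//; lra.
have [hyr fhy] := hP y yd.
rewrite (le_lt_trans (lip _ _ hyr hr))// /q /= fhy fh -linearB.
have := BC (y - z).
have : C * `|y - z| < e / 4.
  by move: y2; rewrite ltr_pdivlMr ?mulr_gt0// ltr_pdivlMr//; lra.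
lra.
Qed.

(* Differentiating [f o h = id] expresses the differential of [h] through the
   first derivatives of [f] at [h], so [h] gains one derivative at each step. *)
Lemma smooth_inverse (f h : R * R -> R * R) (U U' : set (R * R)) :
  open U -> open U' -> smooth_on U f -> (forall x, U x -> jacobian2 f x != 0) ->
  (forall z, U' z -> [/\ U (h z), f (h z) = z & {for z, continuous h}]) ->
  smooth_on U' h.
Proof.
move=> oU oU' Cf J0 hP.
have hU z : U' z -> U (h z) by move=> /hP[].
pose a z := 'D_(1, 0) f (h z); pose b z := 'D_(0, 1) f (h z).
have dh z : U' z -> is_diff z h (inv2 (a z) (b z)).
  move=> U'z; have [Uhz fhz chz] := hP z U'z.
  have df : differentiable f (h z) by exact: Ck_on_diff (Cf 1%N) Uhz.
  apply: (@inverse_is_diff _ _ _ f) => //.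
  - exact: inv2_continuous.
  - by rewrite /a /b !deriveE//; apply: inv2K; exact: J0.
  - near=> y; have /hP [] // : U' y by near: y; exact: open_nbhs_nbhs.
elim=> [|k IH]; first by move=> z /hP[].
split; first by move=> z /dh [].
move=> v.
have Ca : Ck_on k U' a.
  exact: (Ck_on_comp oU' oU hU IH (Ck_on_derive ((1, 0) : R * R) (Cf k.+1))).
have Cb : Ck_on k U' b.
  exact: (Ck_on_comp oU' oU hU IH (Ck_on_derive ((0, 1) : R * R) (Cf k.+1))).
have Cc (c : R) : Ck_on k U' (cst c : R * R -> R) by exact: Ck_on_cst.
have Cdet (u w : R * R -> R * R) : Ck_on k U' u -> Ck_on k U' w ->
    Ck_on k U' (fun z => det2 (u z) (w z)).
  move=> Cu Cw; rewrite /det2.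
  have C1 := Ck_onM oU' (Ck_on_fst oU' Cu) (Ck_on_snd oU' Cw).
  have C2 := Ck_onM oU' (Ck_on_snd oU' Cu) (Ck_on_fst oU' Cw).
  apply: Ck_on_ext (Ck_onD oU' C1 (Ck_onZ (-1) oU' C2)) => // z _.
  by rewrite scaleN1r.
have CV : Ck_on k U' (fun z => (det2 (a z) (b z))^-1).
  apply: Ck_onV => //; last exact: Cdet.
  move=> z /hU Uz; have df : differentiable f (h z) by exact: Ck_on_diff (Cf 1%N) Uz.
  by rewrite /a /b !deriveE//; exact: J0.
have Cv : Ck_on k U' (cst v : R * R -> R * R) by exact: Ck_on_cst.
have C1 := Ck_onM oU' (Cdet _ _ Cv Cb) CV.
have C2 := Ck_onM oU' (Cdet _ _ Ca Cv) CV.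
apply: Ck_on_ext (Ck_on_pair oU' C1 C2) => // z; rewrite inE => /dh [dhz hE].
by rewrite deriveE// hE.
Unshelve. all: by end_near. Qed.

End LocalInverse.

(** * Charts and local diffeomorphisms *)

Section ChartCalculus.
Context {R : realType}.

Lemma Ck_on_local (V W : normedModType R) k (U : set V) (f : V -> W) :
  (forall y, U y -> exists2 U', open U' /\ U' y & Ck_on k U' f) -> Ck_on k U f.
Proof.
elim: k f => [|k IH] f H.
  by move=> y /H [U' [_ U'y]]; apply.
split=> [y /H [U' [_ U'y]] [df _]|v]; first exact: df.
by apply: IH => y /H [U' oU' [_ Df]]; exists U' => //; exact: Df.
Qed.

Context (S : orientedSurface R).

Lemma chart_atP (p : S) : atlas (chart_at p) /\ chart_dom (chart_at p) p.
Proof. by rewrite /chart_at; case: cid. Qed.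

Lemma chart_img_map (a : chart R S) p : chart_dom a p -> chart_img a (chart_map a p).
Proof. by move=> ap; exists p. Qed.

Lemma open_chart_img (a : chart R S) : open (chart_img a).
Proof. exact: chart_img_open. Qed.

Lemma near_chart_dom (T : topologicalType) (h : T -> S) (a : chart R S) y :
  {for y, continuous h} -> chart_dom a (h y) ->
  \forall z \near y, chart_dom a (h z).
Proof.
move=> ch ay; apply: ch; apply: open_nbhs_nbhs; split => //.
exact: chart_dom_open.
Qed.

Lemma near_chartK (W : Type) (T : topologicalType) (h : T -> S) (f : S -> W)
    (a : chart R S) y :
  {for y, continuous h} -> chart_dom a (h y) ->
  {near y, (f \o chart_inv a) \o (chart_map a \o h) =1 f \o h}.
Proof.
move=> ch ay; have := near_chart_dom ch ay.
by apply: filterS => z az /=; rewrite chart_mapK.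
Qed.

(** Near [y] the composite [f \o h] factors through the chart at [h y], the chart in which [tdiff]
    is read at that point, so the chain rule applies. *)
Lemma tdiff_comp (V W : normedModType R) (h : V -> S) (f : S -> W) (y : V) :
  {for y, continuous h} ->
  differentiable (chart_map (chart_at (h y)) \o h) y ->
  differentiable (f \o chart_inv (chart_at (h y)))
    (chart_map (chart_at (h y)) (h y)) ->
  is_diff y (f \o h)
    (tdiff f (h y) \o 'd (chart_map (chart_at (h y)) \o h) y).
Proof.
move=> ch dh df; have [_ bp] := chart_atP (h y).
apply: near_eq_is_diff (near_chartK f ch bp) _.
by apply: is_diff_comp; exact: differentiableP.
Qed.

Lemma smooth_fun_differentiable (W : normedModType R) (f : S -> W) p :
  smooth_fun f ->
  differentiable (f \o chart_inv (chart_at p)) (chart_map (chart_at p) p).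
Proof.
move=> sf; have [ab bp] := chart_atP p.
by apply: Ck_on_diff (sf _ ab 1%N) _; exact: chart_img_map.
Qed.

Lemma transition_differentiable (a b : chart R S) p :
  atlas a -> atlas b -> chart_dom a p -> chart_dom b p ->
  differentiable (chart_map b \o chart_inv a) (chart_map a p).
Proof.
move=> aa ab ap bp; apply: Ck_on_diff (atlas_smooth aa ab 1%N) _.
by exists p.
Qed.

Lemma tdiff_chart (W : normedModType R) (f : S -> W) (a : chart R S) p :
  smooth_fun f -> atlas a -> chart_dom a p ->
  'd (f \o chart_inv a) (chart_map a p) =
  tdiff f p \o 'd (chart_map (chart_at p) \o chart_inv a) (chart_map a p)
    :> (R * R -> W).
Proof.
move=> sf aa ap; have [ab bp] := chart_atP p.
have ci : {for chart_map a p, continuous (chart_inv a)}.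
  by apply: chart_inv_continuous; exact: chart_img_map.
have E : chart_inv a (chart_map a p) = p by rewrite chart_mapK.
have := @tdiff_comp _ _ (chart_inv a) f (chart_map a p) ci.
rewrite E => H.
by have [_ ->] := H (transition_differentiable aa ab ap bp)
  (smooth_fun_differentiable p sf).
Qed.

Lemma det2_comp (A B : {linear (R * R)%type -> (R * R)%type}) :
  det2 (A (B (1, 0))) (A (B (0, 1))) =
  det2 (A (1, 0)) (A (0, 1)) * det2 (B (1, 0)) (B (0, 1)).
Proof.
rewrite [in LHS](pair_basis (B (1, 0))) [in LHS](pair_basis (B (0, 1))).
rewrite !linearD !linearZ /=.
move: (A (1, 0)) (A (0, 1)) (B (1, 0)) (B (0, 1)) => [a b] [c d] [e f] [g h].
by rewrite /det2 /= -![_ *: (_ : R)]/(_ * _); ring.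
Qed.

(** Determinants multiply under composition and transition maps preserve orientation, so the sign
    found in [chart_at p] holds in every chart of the atlas. *)
Lemma jacobian2_chart (K : S -> R * R) (a : chart R S) p :
  smooth_fun K -> atlas a -> chart_dom a p ->
  0 < det2 (tdiff K p (1, 0)) (tdiff K p (0, 1)) ->
  0 < jacobian2 (K \o chart_inv a) (chart_map a p).
Proof.
move=> sK aa ap K0; have [ab bp] := chart_atP p.
rewrite /jacobian2 (tdiff_chart sK aa ap).
have := det2_comp ('d (K \o chart_inv (chart_at p)) (chart_map (chart_at p) p))
  ('d (chart_map (chart_at p) \o chart_inv a) (chart_map a p)).
move=> /= ->; apply: mulr_gt0; first exact: K0.
exact: (atlas_oriented aa ab ap bp).
Qed.

(** Regularity is local: where [h] stays in one chart, [K \o h] is the composite of two planar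
    expressions. *)
Lemma Ck_on_chart_comp k (V : normedModType R) (U : set V) (h : V -> S)
    (K : S -> R * R) :
  open U -> (forall y, U y -> {for y, continuous h}) -> smooth_fun K ->
  (forall a, atlas a -> Ck_on k [set y | U y /\ chart_dom a (h y)] (chart_map a \o h)) ->
  Ck_on k U (K \o h).
Proof.
move=> oU ch sK Ch; apply: Ck_on_local => y Uy.
have [ab bp] := chart_atP (h y); set b := chart_at (h y) in ab bp *.
have oU' : open [set y | U y /\ chart_dom b (h y)].
  rewrite openE => z [Uz bz]; apply: filterI; first exact: open_nbhs_nbhs.
  by apply: near_chart_dom => //; exact: ch.
exists [set y | U y /\ chart_dom b (h y)] => //.
have hU z : U z /\ chart_dom b (h z) -> chart_img b (chart_map b (h z)).
  by move=> [_ /chart_img_map].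
have C := Ck_on_comp oU' (@open_chart_img b) hU (Ch b ab) (sK b ab k).
apply: (Ck_on_ext oU' _ C).
by move=> z; rewrite inE => -[_ bz] /=; rewrite chart_mapK.
Qed.

End ChartCalculus.

(** * Local sections of a local diffeomorphism and uniqueness of lifts *)

Section LocalDiffeo.
Context {R : realType} (S : orientedSurface R) (K : S -> R * R).
Hypothesis sK : smooth_fun K.
Hypothesis K0 : forall p, 0 < det2 (tdiff K p (1, 0)) (tdiff K p (0, 1)).

Lemma smooth_fun_continuous p : {for p, continuous K}.
Proof.
have [ab bp] := chart_atP p.
have bK : {near p, (K \o chart_inv (chart_at p)) \o chart_map (chart_at p) =1 K}.
  have := @near_chartK R S _ _ id K (chart_at p) p.
  by apply => //; exact: cvg_id.
have : {for p, continuous ((K \o chart_inv (chart_at p)) \o chart_map (chart_at p))}.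
  apply: continuous_comp; first exact: chart_map_continuous.
  apply: Ck_on_continuous (sK ab 0%N) _; exact: chart_img_map.
move=> c; suff : K @ p --> K p by [].
have E : K p = ((K \o chart_inv (chart_at p)) \o chart_map (chart_at p)) p.
  by rewrite (nbhs_singleton bK).
rewrite E; apply: cvg_trans c; exact: near_eq_cvg.
Qed.

(** The normalisation at [K p] selects the branch through [p]. Balls are those of the maximum norm,
    and values of [s] outside the ball are junk. *)
Definition section_on (p : S) (r : R) (s : R * R -> S) : Prop :=
  s (K p) = p /\
  forall z, `|z - K p| < r -> K (s z) = z /\ {for z, continuous s}.

Lemma local_diffeo p :
  (exists2 N, nbhs p N & forall q q', N q -> N q' -> K q = K q' -> q = q') /\
  exists2 r, 0 < r & exists s, section_on p r s.
Proof.
have [ab bp] := chart_atP p; set b := chart_at p in ab bp *.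
have J0 : jacobian2 (K \o chart_inv b) (chart_map b p) != 0.
  by rewrite gt_eqF//; exact: jacobian2_chart.
have [r [d [h [r0 d0 rU inj hP]]]] := local_inverse (@open_chart_img R S b)
  (chart_img_map bp) (sK ab 1%N) J0.
have Ep : K (chart_inv b (chart_map b p)) = K p by rewrite chart_mapK.
split.
  exists [set q | chart_dom b q /\ `|chart_map b q - chart_map b p| < r].
    apply: filterI.
      by apply: open_nbhs_nbhs; split => //; exact: chart_dom_open.
    have /cvgrPdist_lt /(_ r r0) : chart_map b @ p --> chart_map b p.
      exact: chart_map_continuous.
    by apply: filterS => q; rewrite distrC.
  move=> q q' [bq qr] [bq' q'r] Kqq'.
  rewrite -(chart_mapK bq) -(chart_mapK bq'); congr chart_inv.
  by apply: inj => //=; rewrite !chart_mapK.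
exists d => //; exists (chart_inv b \o h); split.
  have [|hr Kh _] := hP (K p); first by rewrite /= Ep subrr normr0.
  rewrite /= -[RHS](chart_mapK bp); congr chart_inv.
  (* Injectivity near [p] forces the local inverse to return to [p] itself, which is the
     normalisation in [section_on]. *)
  apply: inj => //; first by rewrite subrr normr0.
  by rewrite Kh /= Ep.
move=> z zd; have [|hr Kh ch] := hP z; first by rewrite /= Ep.
split => //; apply: continuous_comp => //.
by apply: chart_inv_continuous; exact: rU.
Qed.

(** The set where the lifts agree is relatively open, because [K] is locally injective, and
    relatively closed, because the surface is Hausdorff. *)
Lemma lift_unique (T : topologicalType) (A : set T) (f g : T -> S) x0 x :
  connected A ->
  (forall x, A x ->
    [/\ {for x, continuous f}, {for x, continuous g} & K (f x) = K (g x)]) ->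
  A x0 -> f x0 = g x0 -> A x -> f x = g x.
Proof.
move=> cA fgP Ax0 fgx0 Ax.
suff : A `&` [set y | f y = g y] = A by move=> E; rewrite -E in Ax; case: Ax.
apply: cA; first by exists x0.
- exists (interior [set y | A y -> f y = g y]); first exact: open_interior.
  apply/seteqP; split=> y [Ay]; last by move=> /interior_subset /= H; split => //; exact: H.
  move=> fgy; split => //; have [cf cg _] := fgP y Ay.
  have [[N pN Ninj] _] := local_diffeo (f y).
  have h1 : \forall z \near y, N (f z) by exact: cf.
  have h2 : \forall z \near y, N (g z) by apply: cg; rewrite -fgy.
  rewrite /interior /=; near=> z; move=> Az.
  by apply: Ninj; [near: z|near: z|have [] := fgP z Az].
- exists (~` (interior [set y | A y -> f y <> g y])).
    by apply: open_closedC; exact: open_interior.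
  apply/seteqP; split=> y [Ay].
    by move=> fgy; split => // /interior_subset /(_ Ay).
  move=> H; split => //; apply: contrapT => fgy; apply: H.
  have [cf cg _] := fgP y Ay.
  have := surface_hausdorff (o := S); rewrite open_hausdorff => /(_ (f y) (g y)).
  have /eqP fgy' := fgy.
  move=> /(_ fgy') [[B C] /= [fB gC] [oB oC BC]].
  rewrite !inE in fB gC.
  have h1 : \forall z \near y, B (f z) by apply: cf; exact: open_nbhs_nbhs.
  have h2 : \forall z \near y, C (g z) by apply: cg; exact: open_nbhs_nbhs.
  rewrite /interior /=; near=> z; move=> _ E.
  have Bz : B (f z) by near: z.
  have Cz : C (g z) by near: z.
  have : (B `&` C) (f z) by split => //; rewrite E.
  by rewrite (eqP BC).
Unshelve. all: by end_near. Qed.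

End LocalDiffeo.

(** * Lengths of curves *)

Section Lengths.
Context {R : realType}.
Local Notation mu := (@lebesgue_measure R).

Lemma Ck_on1_derive1_continuous (f : R -> R) (U : set R) t :
  Ck_on 1 U f -> U t -> {for t, continuous (derive1 f)}.
Proof.
move=> Cf Ut; have -> : (derive1 f) = 'D_1 f by apply/funext => x; rewrite derive1E.
exact: Ck_on_continuous (Ck_on_derive (1 : R) Cf) Ut.
Qed.

Lemma measurable_continuous_segment (f : R -> R) (a b : R) :
  (forall t : R, a <= t <= b -> {for t, continuous f}) ->
  measurable_fun `[a, b] (EFin \o f).
Proof.
move=> cf; apply/measurable_EFinP.
apply: subspace_continuous_measurable_fun => //.
by apply: continuous_in_subspaceT => t; rewrite inE /= in_itv /=; exact: cf.
Qed.

(** Fundamental theorem of calculus on the subinterval, then enlargement of the domain of a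
    nonnegative integrand. The case [t0 = t1] is separate because the fundamental theorem is applied
    on a proper interval. *)
Lemma dist_le_integral_derive (f : R -> R) (e t0 t1 : R) :
  0 < e -> Ck_on 1 [set t : R | - e < t < 1 + e] f -> 0 <= t0 -> t0 <= t1 -> t1 <= 1 ->
  (`|f t1 - f t0|%:E <= \int[mu]_(t in `[0%R, 1%R]) `|derive1 f t|%:E)%E.
Proof.
move=> e0 Cf t00 t01 t11.
have Ut (t : R) : 0 <= t <= 1 -> - e < t < 1 + e.
  by move=> /andP[? ?]; apply/andP; split; lra.
have cf' (t : R) : 0 <= t <= 1 -> {for t, continuous (derive1 f)}.
  by move=> t01'; exact: Ck_on1_derive1_continuous Cf (Ut t t01').
have df (t : R) : 0 <= t <= 1 -> differentiable f t.
  by move=> t01'; exact: Ck_on_diff Cf (Ut t t01').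
have cn (t : R) : 0 <= t <= 1 -> {for t, continuous (fun t => `|derive1 f t|)}.
  by move=> /cf' c; apply: cvg_norm; exact: c.
have sub (t : R) : t0 <= t <= t1 -> 0 <= t <= 1.
  by move=> /andP[? ?]; apply/andP; split; lra.
have := t01; rewrite le_eqVlt => /predU1P[->|t01'].
  by rewrite subrr normr0; apply: integral_ge0 => t _; rewrite lee_fin.
have FTC : (\int[mu]_(t in `[t0, t1]) (derive1 f t)%:E = (f t1)%:E - (f t0)%:E)%E.
  apply: continuous_FTC2 => //.
    apply: continuous_in_subspaceT => t; rewrite inE /= in_itv /= => /sub.
    exact: cf'.
  have cc (t : R) : 0 <= t <= 1 -> f @ t --> f t.
    by move=> /df /differentiable_continuous.
  split.
  - move=> t; rewrite in_itv /= => /andP[h1 h2]; apply: diff_derivable; apply: df.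
    by apply: sub; rewrite !ltW.
  - by apply: cvg_at_right_filter; apply: cc; apply: sub; rewrite lexx ltW.
  - by apply: cvg_at_left_filter; apply: cc; apply: sub; rewrite lexx ltW.
have -> : `|f t1 - f t0|%:E = `|\int[mu]_(t in `[t0, t1]) (derive1 f t)%:E|%E.
  by rewrite FTC.
apply: le_trans.
  apply: le_abse_integral; first exact: measurable_itv.
  by apply: measurable_continuous_segment => t /sub; exact: cf'.
apply: (@ge0_subset_integral _ _ R mu `[t0, t1] `[0%R, 1%R]).
- exact: measurable_itv.
- exact: measurable_itv.
- by apply: (@measurable_continuous_segment (fun t => `|derive1 f t|)) => t; exact: cn.
- by move=> t _; exact: abse_ge0.
- by move=> t; rewrite /= !in_itv /= => /sub.
Qed.

(** Lengths are Euclidean while balls use the maximum norm; this comparison and the next pass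
    between them. *)
Lemma sqrt_dot2_ge (w : R * R) :
  `|w.1| <= Num.sqrt (dot2 w w) /\ `|w.2| <= Num.sqrt (dot2 w w).
Proof.
have d0 : 0 <= dot2 w w by rewrite /dot2 -!expr2 addr_ge0 ?sqr_ge0.
by rewrite -!sqrtr_sqr !ler_sqrt // /dot2 -!expr2; split;
  [rewrite lerDl|rewrite lerDr]; exact: sqr_ge0.
Qed.

Lemma sqrt_dot2_le (w : R * R) : Num.sqrt (dot2 w w) <= 2 * `|w|.
Proof.
have h1 := norm_fst_le w; have h2 := norm_snd_le w.
have h0 : 0 <= 2 * `|w| by rewrite mulr_ge0.
rewrite -(ger0_norm h0) -sqrtr_sqr ler_sqrt ?sqr_ge0// /dot2.
rewrite -!expr2 -(real_normK (num_real w.1)) -(real_normK (num_real w.2)).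
have i1 : `|w.1| ^+ 2 <= `|w| ^+ 2 by rewrite lerXn2r// nnegrE.
have i2 : `|w.2| ^+ 2 <= `|w| ^+ 2 by rewrite lerXn2r// nnegrE.
have i3 : 0 <= `|w| ^+ 2 by exact: sqr_ge0.
rewrite exprMn; lra.
Qed.

Context (S : orientedSurface R) (K : S -> R * R) (g : tensor2 S) (s : R).
Hypothesis sK : smooth_fun K.
Hypothesis K0 : forall p, 0 < det2 (tdiff K p (1, 0)) (tdiff K p (0, 1)).
Hypothesis s0 : 0 < s.
Hypothesis gK : forall p u, g p u u = s ^+ 2 * dot2 (tdiff K p u) (tdiff K p u).

Lemma open_extended_unit_itv (e : R) : open [set t : R | - e < t < 1 + e].
Proof.
have -> : [set t : R | - e < t < 1 + e] = [set` `]- e, 1 + e[].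
  by apply/seteqP; split => t; rewrite /= in_itv.
exact: interval_open.
Qed.

(** Moves length computations to the plane. [velocity] is read in the same chart as [tdiff], so the
    chain rule matches the two speeds. *)
Lemma C1_curve_push (gamma : R -> S) : C1_curve gamma ->
  exists2 e : R, 0 < e &
    [/\ forall t : R, - e < t < 1 + e -> {for t, continuous gamma},
        Ck_on 1 [set t : R | - e < t < 1 + e] (K \o gamma) &
        forall t : R, - e < t < 1 + e ->
          Num.sqrt (g (gamma t) (velocity gamma t) (velocity gamma t)) =
          s * Num.sqrt (dot2 ((derive1 (K \o gamma)) t) ((derive1 (K \o gamma)) t))].
Proof.
move=> [e e0 [cg Cg]]; exists e => //.
have oU := @open_extended_unit_itv e.
have CK : Ck_on 1 [set t : R | - e < t < 1 + e] (K \o gamma).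
  exact: Ck_on_chart_comp.
split => // t te.
have [ab bp] := chart_atP (gamma t).
have db : differentiable (chart_map (chart_at (gamma t)) \o gamma) t.
  by apply: Ck_on_diff (Cg _ ab) _.
have dK := smooth_fun_differentiable (gamma t) sK.
have [dKg E] := tdiff_comp (cg t te) db dK.
rewrite gK sqrtrM ?sqr_ge0// sqrtr_sqr gtr0_norm//; congr (s * Num.sqrt _).
suff -> : (derive1 (K \o gamma)) t = tdiff K (gamma t) (velocity gamma t) by [].
by rewrite derive1E'// E /= /velocity derive1E'.
Qed.

Lemma derive1_pair (f : R -> R * R) (U : set R) t : open U -> Ck_on 1 U f -> U t ->
  derive1 (fun x => (f x).1) t = (derive1 f t).1 /\
  derive1 (fun x => (f x).2) t = (derive1 f t).2.
Proof.
move=> oU Cf Ut; have df := Ck_on_diff Cf Ut.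
rewrite !derive1E' //; first 1 last.
- exact: Ck_on_diff (Ck_on_snd oU Cf) Ut.
- exact: Ck_on_diff (Ck_on_fst oU Cf) Ut.
have c1 := @fst_continuous R R; have c2 := @snd_continuous R R.
split.
  have [_ ] := is_diff_comp (differentiableP df)
    (is_diff_linear (A := (fst : {linear (R * R)%type -> R})) (f t) c1).
  by move=> /(congr1 (fun h => h 1)).
have [_ ] := is_diff_comp (differentiableP df)
  (is_diff_linear (A := (snd : {linear (R * R)%type -> R})) (f t) c2).
by move=> /(congr1 (fun h => h 1)).
Qed.

(** The maximum norm is attained by one coordinate, whose derivative is bounded by the Euclidean
    speed, so a one-dimensional estimate suffices. General endpoints allow the bound to be used on
    the tail of a curve. *)
Lemma curve_length_ge (gamma : R -> S) (t0 t1 : R) : C1_curve gamma ->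
  0 <= t0 -> t0 <= t1 -> t1 <= 1 ->
  ((s * `|K (gamma t1) - K (gamma t0)|)%:E <= curve_length g gamma)%E.
Proof.
move=> Cg t00 t01 t11.
have [e e0 [cg CK sp]] := C1_curve_push Cg.
have oU := @open_extended_unit_itv e.
have Ut (t : R) : 0 <= t <= 1 -> - e < t < 1 + e.
  by move=> /andP[? ?]; apply/andP; split; lra.
pose f := K \o gamma.
have C1 := Ck_on_fst oU CK; have C2 := Ck_on_snd oU CK.
have cD (t : R) : 0 <= t <= 1 ->
    {for t, continuous (fun t => s * Num.sqrt (dot2 (derive1 f t) (derive1 f t)))}.
  move=> /Ut te.
  have c1 : (derive1 (fun x => (f x).1)) @ t --> derive1 (fun x => (f x).1) t.
    exact: Ck_on1_derive1_continuous C1 te.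
  have c2 : (derive1 (fun x => (f x).2)) @ t --> derive1 (fun x => (f x).2) t.
    exact: Ck_on1_derive1_continuous C2 te.
  have [E1 E2] := derive1_pair oU CK te.
  suff H : (fun t => s * Num.sqrt (derive1 (fun x => (f x).1) t * derive1 (fun x => (f x).1) t +
    derive1 (fun x => (f x).2) t * derive1 (fun x => (f x).2) t)) @ t -->
    s * Num.sqrt (dot2 (derive1 f t) (derive1 f t)).
    apply: cvg_trans H; apply: near_eq_cvg.
    near=> x.
    have xe : - e < x < 1 + e by near: x; exact: (open_nbhs_nbhs (conj oU te)).
    by have [-> ->] := derive1_pair oU CK xe.
  rewrite /dot2 -E1 -E2; apply: cvgMl_tmp.
  apply: continuous_cvg; first exact: sqrt_continuous.
  by apply: cvgD; apply: cvgM.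
have bound (h : R -> R) : Ck_on 1 [set t : R | - e < t < 1 + e] h ->
    (forall t : R, 0 <= t <= 1 -> `|derive1 h t| <= Num.sqrt (dot2 (derive1 f t) (derive1 f t))) ->
    ((s * `|h t1 - h t0|)%:E <= curve_length g gamma)%E.
  move=> Ch hle.
  have Csh : Ck_on 1 [set t : R | - e < t < 1 + e] (fun t => s *: h t).
    exact: Ck_onZ.
  have shE (t : R) : 0 <= t <= 1 -> (derive1 (fun t => s *: h t)) t = s * (derive1 h) t.
    move=> /Ut te; rewrite !derive1E [LHS]deriveZ//.
    by apply: diff_derivable; exact: Ck_on_diff Ch te.
  have -> : s * `|h t1 - h t0| = `|s *: h t1 - s *: h t0|.
    by rewrite -scalerBr normrZ gtr0_norm.
  apply: le_trans (dist_le_integral_derive e0 Csh t00 t01 t11) _.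
  apply: ge0_le_integral.
  - exact: measurable_itv.
  - by move=> t _; rewrite lee_fin.
  - apply: (@measurable_continuous_segment (fun t => `|(derive1 (fun t => s *: h t)) t|)) => t /Ut te.
    apply: cvg_norm; exact: Ck_on1_derive1_continuous Csh te.
  - apply: (@eq_measurable_fun _ _ _ _ _
      (EFin \o (fun t => s * Num.sqrt (dot2 (derive1 f t) (derive1 f t))))).
      by move=> t; rewrite inE /= in_itv /= => /Ut te; rewrite sp.
    exact: measurable_continuous_segment.
  - move=> t; rewrite /= in_itv /= => t01'; rewrite lee_fin sp; last exact: Ut.
    by rewrite shE// normrM gtr0_norm// ler_pM2l//; exact: hle.
have [L|L] := leP `|(f t1).1 - (f t0).1| `|(f t1).2 - (f t0).2|.
  have -> : `|K (gamma t1) - K (gamma t0)| = `|(f t1).2 - (f t0).2|.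
    by rewrite -[LHS]/(Num.max `|(f t1).1 - (f t0).1| `|(f t1).2 - (f t0).2|) (max_idPr L).
  apply: bound C2 _ => t /Ut te; have [_ ->] := derive1_pair oU CK te.
  by have [] := sqrt_dot2_ge (derive1 f t).
have -> : `|K (gamma t1) - K (gamma t0)| = `|(f t1).1 - (f t0).1|.
  by rewrite -[LHS]/(Num.max `|(f t1).1 - (f t0).1| `|(f t1).2 - (f t0).2|) (max_idPl (ltW L)).
apply: bound C1 _ => t /Ut te; have [-> _] := derive1_pair oU CK te.
by have [] := sqrt_dot2_ge (derive1 f t).
Unshelve. all: by end_near. Qed.

End Lengths.

(** * Lifting segments *)

Section Completeness.
Context {R : realType}.
Context (S : orientedSurface R) (K : S -> R * R) (g : tensor2 S) (s : R).
Hypothesis sK : smooth_fun K.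
Hypothesis K0 : forall p, 0 < det2 (tdiff K p (1, 0)) (tdiff K p (0, 1)).
Hypothesis s0 : 0 < s.
Hypothesis gK : forall p u, g p u u = s ^+ 2 * dot2 (tdiff K p u) (tdiff K p u).

(** A continuous section is automatically smooth: in a chart it is a continuous inverse of a smooth
    map with nonzero Jacobian. *)
Lemma lift_smooth (U : set (R * R)) (h : R * R -> S) (a : chart R S) :
  open U -> (forall z, U z -> K (h z) = z /\ {for z, continuous h}) -> atlas a ->
  open [set z | U z /\ chart_dom a (h z)] /\
  smooth_on [set z | U z /\ chart_dom a (h z)] (chart_map a \o h).
Proof.
move=> oU hP aa.
have oU' : open [set z | U z /\ chart_dom a (h z)].
  rewrite openE => z [Uz bz]; apply: filterI; first exact: open_nbhs_nbhs.
  by have [_ cz] := hP z Uz; exact: (near_chart_dom cz bz).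
split => //.
apply: (@smooth_inverse _ (K \o chart_inv a) _ (chart_img a)) => //.
- exact: open_chart_img.
- exact: sK.
- move=> _ [p ap <-]; rewrite gt_eqF//; exact: jacobian2_chart.
- move=> z [Uz az]; have [Kz cz] := hP z Uz; split.
  + exact: chart_img_map.
  + by rewrite /= chart_mapK.
  + by apply: continuous_comp => //; exact: chart_map_continuous.
Qed.

Lemma open_dist_ball (c : R * R) (r : R) : open [set z : R * R | `|z - c| < r].
Proof.
rewrite openE => z /= zr.
suff : \forall y \near z, `|y - c| < r by [].
apply/near_distP; exists (r - `|z - c|); first by rewrite subr_gt0.
by move=> y yz; rewrite (le_lt_trans (ler_distD z _ _))//; lra.
Qed.

Lemma Ck_on_segment (z w : R * R) k (U : set R) :
  open U -> Ck_on k U (fun t : R => z + t *: w).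
Proof.
move=> oU.
have C1 : Ck_on k U (fun t : R => z.1 + w.1 *: t).
  by apply: Ck_onD => //; [exact: Ck_on_cst|apply: Ck_onZ => //; exact: Ck_on_id].
have C2 : Ck_on k U (fun t : R => z.2 + w.2 *: t).
  by apply: Ck_onD => //; [exact: Ck_on_cst|apply: Ck_onZ => //; exact: Ck_on_id].
apply: (Ck_on_ext oU _ (Ck_on_pair oU C1 C2)) => t _.
by apply/pair_equal_spec; split; rewrite /= -![_ *: (_ : R)]/(_ * _) mulrC.
Qed.

(** [C1_curve] asks for a neighbourhood of the unit interval, so the segment is prolonged past both
    ends. [m] is the room left at the endpoints, and the [+ 1] in [L] keeps the divisor positive
    when the endpoints coincide. *)
Lemma ball_segment_open (c z0 z1 : R * R) (r : R) :
  `|z0 - c| < r -> `|z1 - c| < r ->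
  exists2 e : R, 0 < e & forall t : R, - e < t < 1 + e ->
    `|z0 + t *: (z1 - z0) - c| < r.
Proof.
move=> z0r z1r; pose L := `|z1 - z0| + 1.
have L0 : 0 < L by rewrite ltr_wpDl.
pose m := Num.min (r - `|z0 - c|) (r - `|z1 - c|).
have m0 : 0 < m by rewrite lt_min !subr_gt0 z0r.
exists (m / L); first by rewrite divr_gt0.
move=> t /andP[t1 t2].
have key (u : R) (y : R * R) : `|u| < m / L -> m <= r - `|y - c| ->
    `|y + u *: (z1 - z0) - c| < r.
  rewrite ltr_pdivlMr// => uL my.
  rewrite addrAC (le_lt_trans (ler_normD _ _))// normrZ.
  have : `|u| * `|z1 - z0| <= `|u| * L by rewrite ler_wpM2l// /L lerDl.
  lra.
have mz0 : m <= r - `|z0 - c| by rewrite /m ge_min lexx.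
have mz1 : m <= r - `|z1 - c| by rewrite /m ge_min lexx orbT.
have [tn|tp] := ltP t 0.
  by apply: key => //; rewrite ltr0_norm//; lra.
have [tl|tg] := leP t 1; first by apply: ball_segment => //; rewrite tp.
have -> : z0 + t *: (z1 - z0) = z1 + (t - 1) *: (z1 - z0).
  by rewrite scalerBl scale1r (addrC (t *: _)) addrA opprB subrKC.
by apply: key => //; rewrite gtr0_norm; lra.
Qed.

(** The curve is the image of the segment under [h]. Its projection by [K] is the segment again, so
    its speed is constant. *)
Lemma joined_segment (c z0 z1 : R * R) (r : R) (h : R * R -> S) :
  (forall z, `|z - c| < r -> K (h z) = z /\ {for z, continuous h}) ->
  `|z0 - c| < r -> `|z1 - c| < r ->
  exists2 l, joined g (h z0) (h z1) l & (l <= (2 * s * `|z1 - z0|)%:E)%E.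
Proof.
move=> hP z0r z1r.
have [e e0 er] := ball_segment_open z0r z1r.
pose ell t : R * R := z0 + t *: (z1 - z0); pose gamma t := h (ell t).
have oT := @open_extended_unit_itv R e.
have Cell k : Ck_on k [set t : R | - e < t < 1 + e] ell by exact: Ck_on_segment.
have cg (t : R) : - e < t < 1 + e -> {for t, continuous gamma}.
  move=> te; apply: continuous_comp; first exact: Ck_on_continuous (Cell 0%N) te.
  by have [] := hP (ell t) (er t te).
have Cg : C1_curve gamma.
  exists e => //; split => // a aa.
  have oB := @open_dist_ball c r.
  have [oU CU] := lift_smooth oB hP aa.
  have oT' : open [set t : R | - e < t < 1 + e /\ chart_dom a (gamma t)].
    rewrite openE => t [te at']; apply: filterI; first exact: (open_nbhs_nbhs (conj oT te)).
    exact: (near_chart_dom (cg t te) at').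
  have sub : [set t : R | - e < t < 1 + e /\ chart_dom a (gamma t)] `<=`
    [set t : R | - e < t < 1 + e] by move=> t [].
  have hU (t : R) : - e < t < 1 + e /\ chart_dom a (gamma t) ->
      `|ell t - c| < r /\ chart_dom a (h (ell t)).
    by move=> [te at']; split => //; exact: er.
  exact: (Ck_on_comp oT' oU hU (Ck_on_sub sub (Cell 1%N)) (CU 1%N)).
have g0 : gamma 0 = h z0 by rewrite /gamma /ell scale0r addr0.
have g1 : gamma 1 = h z1 by rewrite /gamma /ell scale1r subrKC.
exists (curve_length g gamma + 0)%E.
  by rewrite -g0; apply: joined_step => //; rewrite g1; exact: joined_refl.
rewrite adde0.
have [e' e'0 [_ CK sp]] := C1_curve_push sK s0 gK Cg.
have spE (t : R) : 0 <= t <= 1 ->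
    Num.sqrt (g (gamma t) (velocity gamma t) (velocity gamma t)) =
    s * Num.sqrt (dot2 (z1 - z0) (z1 - z0)).
  move=> /andP[t0 t1].
  have te : - e < t < 1 + e by apply/andP; split; lra.
  have te' : - e' < t < 1 + e' by apply/andP; split; lra.
  rewrite sp //; suff -> : derive1 (K \o gamma) t = z1 - z0 by [].
  rewrite derive1E.
  have nE : \forall x \near t, (K \o gamma) x = ell x.
    near=> x.
    have xe : - e < x < 1 + e by near: x; exact: (open_nbhs_nbhs (conj oT te)).
    by have [] := hP (ell x) (er x xe).
  rewrite (near_eq_derive _ nE).
  have [_ E] := @is_derive_segment R _ _ (id : R * R -> R * R) z0 (z1 - z0) t ex_diff.
  by rewrite [LHS]E derive_id.
rewrite /curve_length (eq_integral (cst (s * Num.sqrt (dot2 (z1 - z0) (z1 - z0)))%:E)); last first.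
  by move=> t; rewrite inE /= in_itv /= => /spE ->.
rewrite integral_cst; last exact: measurable_itv.
have LM : lebesgue_measure (`[0%R, 1%R]%classic : set R) = 1%:E.
  by rewrite lebesgue_measure_itv /= lte_fin ltr01 -EFinB subr0.
rewrite [X in (_ * X)%E](_ : _ = 1%:E); last exact: LM.
rewrite mule1 lee_fin.
by rewrite (mulrC 2 s) -mulrA ler_pM2l//; exact: sqrt_dot2_le.
Unshelve. all: by end_near. Qed.

Lemma joined_trans p q r l l' : joined g p q l -> joined g q r l' ->
  joined g p r (l + l')%E.
Proof.
elim=> [p'|gamma q' l'' Cg _ IH] qr; first by rewrite add0e.
by rewrite -addeA; apply: joined_step => //; exact: IH.
Qed.

Lemma joined_ge0 p q l : joined g p q l -> (0 <= l)%E.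
Proof.
elim=> // gamma q' l' _ _ l'0; apply: adde_ge0 => //.
by apply: integral_ge0 => t _; rewrite lee_fin sqrtr_ge0.
Qed.

(** Short curves cannot leave the sheet of the section. The induction runs from the end [q]
    backwards: the projection of each piece stays in the ball by the length bound, so the piece is
    the lift [h \o K \o gamma] by uniqueness. *)
Lemma joined_in_section q rho (h : R * R -> S) p l :
  section_on K q rho h -> joined g p q l -> (l < (s * rho)%:E)%E ->
  h (K p) = p /\ ((s * `|K p - K q|)%:E <= l)%E.
Proof.
move=> [hq hP] pq; elim: pq hq hP => [p'|gamma q' l' Cg gq IH] hq hP.
  by move=> _; rewrite subrr normr0 mulr0.
move=> llt.
have l'0 := joined_ge0 gq.
have L0 : (0 <= curve_length g gamma)%E.
  by apply: integral_ge0 => t _; rewrite lee_fin sqrtr_ge0.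
have l'lt : (l' < (s * rho)%:E)%E by apply: le_lt_trans llt; rewrite leeDr.
have [h1 d1] := IH hq hP l'lt.
(* The tail of the piece from [t] to 1 and the remaining chain together bound the distance to
   [K q']. *)
have dist (t : R) : 0 <= t <= 1 ->
    ((s * `|K (gamma t) - K q'|)%:E <= curve_length g gamma + l')%E.
  move=> /andP[t0 t1].
  have d2 := curve_length_ge sK s0 gK Cg t0 t1 (lexx 1).
  apply: le_trans (leeD d2 d1); rewrite -EFinD lee_fin -mulrDr ler_pM2l//.
  by rewrite (distrC (K (gamma 1))); exact: ler_distD.
split; last by apply: dist; rewrite lexx ler01.
have [e e0 [cg CK _]] := C1_curve_push sK s0 gK Cg.
have gE : gamma 0 = h (K (gamma 0)).
  apply: (lift_unique sK K0 (x0 := 1) (g := fun t => h (K (gamma t)))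
    (@segment_connected R 0 1)).
  - move=> t; rewrite /= in_itv /= => t01.
    have te : - e < t < 1 + e by move/andP: t01 => [? ?]; apply/andP; split; lra.
    have inb : `|K (gamma t) - K q'| < rho.
      by rewrite -(ltr_pM2l s0) -lte_fin; apply: le_lt_trans llt; exact: dist.
    have [Kh ch] := hP _ inb.
    split; [exact: cg| |by rewrite Kh].
    apply: (@continuous_comp _ _ _ (K \o gamma) h) => //.
    exact: Ck_on_continuous CK te.
  - by rewrite /= in_itv /= ler01 lexx.
  - by rewrite h1.
  - by rewrite /= in_itv /= ler01 lexx.
by rewrite -gE.
Qed.

(** Both balls are convex, so the segment from [x0] to [x] lies in both and carries the agreement
    along. *)
Lemma section_unique (f h : R * R -> S) c c' r r' x0 x :
  (forall z, `|z - c| < r -> K (f z) = z /\ {for z, continuous f}) ->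
  (forall z, `|z - c'| < r' -> K (h z) = z /\ {for z, continuous h}) ->
  `|x0 - c| < r -> `|x0 - c'| < r' -> f x0 = h x0 ->
  `|x - c| < r -> `|x - c'| < r' -> f x = h x.
Proof.
move=> fP hP x0r x0r' fh xr xr'.
pose ell t : R * R := x0 + t *: (x - x0).
have e0 : x0 = ell 0 by rewrite /ell scale0r addr0.
have e1 : x = ell 1 by rewrite /ell scale1r subrKC.
have cell (t : R) : {for t, continuous ell}.
  exact: Ck_on_continuous (Ck_on_segment x0 (x - x0) 0%N openT) _.
rewrite e1; apply: (lift_unique sK K0 (x0 := 0) (f := f \o ell) (g := h \o ell)
  (@segment_connected R 0 1)).
- move=> t; rewrite /= in_itv /= => t01.
  have [Kf cf] := fP (ell t) (ball_segment xr x0r t01).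
  have [Kh ch] := hP (ell t) (ball_segment xr' x0r' t01).
  split; [exact: continuous_comp|exact: continuous_comp|by rewrite Kf Kh].
- by rewrite /= in_itv /= ler01 lexx.
- by rewrite /= -e0.
- by rewrite /= in_itv /= ler01 lexx.
Qed.

End Completeness.

(** * Complete metrics and global sections *)

Section GlobalSection.
Context {R : realType}.
Context (S : orientedSurface R) (K : S -> R * R) (g : tensor2 S) (s : R).
Hypothesis sK : smooth_fun K.
Hypothesis K0 : forall p, 0 < det2 (tdiff K p (1, 0)) (tdiff K p (0, 1)).
Hypothesis s0 : 0 < s.
Hypothesis gK : forall p u, g p u u = s ^+ 2 * dot2 (tdiff K p u) (tdiff K p u).

Lemma section_onW p r r' h : r' <= r -> section_on K p r h -> section_on K p r' h.
Proof. by move=> r'r [hp hP]; split => // z /lt_le_trans /(_ r'r); exact: hP. Qed.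

(* The sections on the half-size balls centred at [h z] all agree with [h], and the
   ball of radius [r] is covered by evaluating at [y] the section centred at the
   midpoint of [K p] and [y]. *)
Lemma section_double p r h : 0 < r -> section_on K p (r / 2) h ->
  (forall z, `|z - K p| < r / 2 -> exists h', section_on K (h z) (r / 2) h') ->
  exists h', section_on K p r h'.
Proof.
move=> r0 [hp hP] hsec.
have : forall z, exists h', `|z - K p| < r / 2 -> section_on K (h z) (r / 2) h'.
  move=> z; have [/hsec [h' h'P]|_] := ltP `|z - K p| (r / 2); first by exists h'.
  by exists h.
move=> /choice [sec secP].
pose mid y : R * R := K p + 2^-1 *: (y - K p).
have midP y : `|y - K p| < r -> `|mid y - K p| < r / 2 /\ `|y - mid y| < r / 2.
  move=> yr.
  have -> : mid y - K p = 2^-1 *: (y - K p) by rewrite /mid addrC addKr.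
  have -> : y - mid y = 2^-1 *: (y - K p).
    have {1}-> : y = K p + 1 *: (y - K p) by rewrite scale1r subrKC.
    rewrite /mid opprD addrACA subrr add0r -scalerBl.
    by have -> : 1 - 2^-1 = 2^-1 :> R by field.
  by rewrite normrZ ger0_norm ?invr_ge0// mulrC ltr_pM2r ?invr_gt0.
have secK z : `|z - K p| < r / 2 -> sec z z = h z /\
    forall w, `|w - z| < r / 2 -> K (sec z w) = w /\ {for w, continuous (sec z)}.
  move=> zr; have [Kz _] := hP z zr; have [secz seczP] := secP z zr.
  by rewrite Kz in secz seczP.
have self (z : R * R) : `|z - z| < r / 2 by rewrite subrr normr0 divr_gt0.
exists (fun y => sec (mid y) y); split.
  have -> : mid (K p) = K p by rewrite /mid subrr scaler0 addr0.
  by have [-> _] := secK (K p) (self _).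
move=> y yr; have [m1 m2] := midP y yr; have [secm secmP] := secK _ m1.
have [Ky cy] := secmP y m2; split => //.
have cmid : {for y, continuous mid}.
  have : Ck_on 0 setT (fun y : R * R => K p + 2^-1 *: (y + - K p)).
    apply: Ck_onD; [exact: openT|exact: Ck_on_cst|].
    apply: Ck_onZ; first exact: openT.
    by apply: Ck_onD; [exact: openT|exact: Ck_on_id|exact: Ck_on_cst].
  by move=> /(_ y I).
have near_ball (c : R * R) (rho : R) (f : R * R -> R * R) :
    {for y, continuous f} -> `|f y - c| < rho -> \forall x \near y, `|f x - c| < rho.
  move=> cf fy.
  exact: (cf _ (open_nbhs_nbhs (conj (@open_dist_ball R c rho) fy))).
(* Near [y] the glued map equals the single section [sec (mid y)]: both sections take the value
   [h (mid x)] at [mid x], hence agree at [x]. *)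
have E : {near y, sec (mid y) =1 (fun y => sec (mid y) y)}.
  near=> x.
  have xr : `|x - K p| < r by near: x; apply: (near_ball _ _ id) => //; exact: cvg_id.
  have xm : `|x - mid y| < r / 2.
    by near: x; apply: (near_ball _ _ id) => //; exact: cvg_id.
  have mm : `|mid x - mid y| < r / 2.
    by near: x; apply: near_ball => //; exact: self.
  have [n1 n2] := midP x xr; have [secx secxP] := secK _ n1.
  have at_mid : sec (mid y) (mid x) = h (mid x).
    exact: (section_unique sK K0 secmP hP (self (mid y)) m1).
  by apply: (section_unique sK K0 secmP secxP mm (self (mid x))) => //; rewrite secx.
suff : (fun y => sec (mid y) y) @ y --> sec (mid y) y by [].
apply: cvg_trans cy; exact: near_eq_cvg.
Unshelve. all: by end_near. Qed.

(** Contrapositive of [section_double]: the new point is [p] itself or some [h z], reached along a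
    lifted segment of length at most 2 s (r / 2). Both directions are recorded since chains are
    oriented and are never reversed. *)
Lemma no_section_step p r : 0 < r -> ~ (exists h, section_on K p r h) ->
  exists p', [/\ ~ (exists h, section_on K p' (r / 2) h),
    exists2 l, joined g p p' l & (l <= (s * r)%:E)%E &
    exists2 l, joined g p' p l & (l <= (s * r)%:E)%E].
Proof.
move=> r0 nA; apply: contrapT => nex.
have [h hs] : exists h, section_on K p (r / 2) h.
  apply: contrapT => nA2; apply: nex; exists p; split => //;
    by exists 0%E; [exact: joined_refl|rewrite lee_fin mulr_ge0// ltW].
apply: nA; apply: (section_double r0 hs) => z zr.
apply: contrapT => nA2; apply: nex; exists (h z); split => //.
  have [hp hP] := hs.
  have pr : `|K p - K p| < r / 2 by rewrite subrr normr0 divr_gt0.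
  have [l jl ll] := joined_segment sK K0 s0 gK hP pr zr.
  exists l; first by rewrite -{1}hp.
  apply: le_trans ll _; rewrite lee_fin (mulrC 2 s) -mulrA ler_pM2l//; lra.
have [hp hP] := hs.
have pr : `|K p - K p| < r / 2 by rewrite subrr normr0 divr_gt0.
have [l jl ll] := joined_segment sK K0 s0 gK hP zr pr.
exists l; first by rewrite -{1}hp.
apply: le_trans ll _; rewrite lee_fin (mulrC 2 s) -mulrA ler_pM2l// distrC; lra.
Qed.

(** The bound is the partial geometric sum of the d / 2^i in telescoped form. *)
Lemma joined_chain (u : nat -> S) (d : R) :
  (forall n, exists2 l, joined g (u n) (u n.+1) l & (l <= (d / 2 ^+ n)%:E)%E) ->
  (forall n, exists2 l, joined g (u n.+1) (u n) l & (l <= (d / 2 ^+ n)%:E)%E) ->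
  forall N k,
    (exists2 l, joined g (u N) (u (N + k)%N) l &
       (l <= (2 * d / 2 ^+ N - 2 * d / 2 ^+ (N + k))%:E)%E) /\
    (exists2 l, joined g (u (N + k)%N) (u N) l &
       (l <= (2 * d / 2 ^+ N - 2 * d / 2 ^+ (N + k))%:E)%E).
Proof.
move=> fw bw N; elim=> [|k [[l jl ll] [l' jl' ll']]].
  by rewrite addn0 subrr; split; exists 0%E => //; exact: joined_refl.
have E : 2 * d / 2 ^+ N - 2 * d / 2 ^+ (N + k.+1) =
    (2 * d / 2 ^+ N - 2 * d / 2 ^+ (N + k)) + d / 2 ^+ (N + k).
  by rewrite addnS exprS; field; rewrite ?expf_neq0.
rewrite E EFinD addnS.
have [m jm lm] := fw (N + k)%N; have [m' jm' lm'] := bw (N + k)%N.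
split.
  by exists (l + m)%E; [exact: joined_trans jl jm|exact: leeD].
by exists (m' + l')%E; [exact: joined_trans jm' jl'|rewrite addeC; exact: leeD].
Qed.

Lemma exists_small_pow (d e : R) : 0 < e ->
  exists N, forall n, (N <= n)%N -> d / 2 ^+ n < e.
Proof.
move=> e0; have [N _ HN] : \forall n \near \oo, d / 2 ^+ n < e.
  have c : (fun n => d / 2 ^+ n) @ \oo --> (0 : R).
    have := @cvg_geometric R d 2^-1; rewrite ger0_norm ?invr_ge0// invf_lt1// ltr1n.
    move=> /(_ isT); apply: cvg_trans; apply: near_eq_cvg; apply: nearW => n.
    by rewrite /geometric /= exprVn.
  have /cvgrPdist_lt /(_ e e0) := c; apply: filterS => n.
  by rewrite sub0r normrN; exact/le_lt_trans/ler_norm.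
by exists N => n Nn; exact: HN.
Qed.

Hypothesis gc : complete_metric g.

Lemma riem_dist_lt p q l (e : R) : joined g p q l -> (l < e%:E)%E ->
  (riem_dist g p q < e%:E)%E.
Proof. by move=> jl; apply: le_lt_trans; exact: ereal_inf_lbound. Qed.

Lemma all_sections p r : 0 < r -> exists h, section_on K p r h.
Proof.
move=> r0; apply: contrapT => nA.
(* Made total for the sake of choice: if the radius is not positive or a section exists, any point
   serves. *)
have : forall x : S * R, exists p', 0 < x.2 -> ~ (exists h, section_on K x.1 x.2 h) ->
  [/\ ~ (exists h, section_on K p' (x.2 / 2) h),
    exists2 l, joined g x.1 p' l & (l <= (s * x.2)%:E)%E &
    exists2 l, joined g p' x.1 l & (l <= (s * x.2)%:E)%E].
  move=> [q t] /=; have [t0|t0] := ltP 0 t; last by exists q.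
  have [A|nA'] := pselect (exists h, section_on K q t h); first by exists q.
  by have [p' p'P] := no_section_step t0 nA'; exists p'.
move=> /choice [F FP].
pose u := fix u n := if n is m.+1 then F (u m, r / 2 ^+ m) else p.
have pos n : 0 < r / 2 ^+ n by rewrite divr_gt0// exprn_gt0.
have half n : r / 2 ^+ n / 2 = r / 2 ^+ n.+1 by rewrite exprSr invfM mulrA.
have nAu n : ~ (exists h, section_on K (u n) (r / 2 ^+ n) h).
  elim: n => [|n IH]; first by rewrite expr0 divr1.
  by have [] := FP (u n, r / 2 ^+ n) (pos n) IH; rewrite /= half.
have fw n : exists2 l, joined g (u n) (u n.+1) l & (l <= ((s * r) / 2 ^+ n)%:E)%E.
  by have [_ + _] := FP (u n, r / 2 ^+ n) (pos n) (nAu n); rewrite /= mulrA.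
have bw n : exists2 l, joined g (u n.+1) (u n) l & (l <= ((s * r) / 2 ^+ n)%:E)%E.
  by have [_ _ +] := FP (u n, r / 2 ^+ n) (pos n) (nAu n); rewrite /= mulrA.
have chain := joined_chain fw bw.
have [|q uq] := @gc u.
  (* Two later terms are joined through [u N] by two chains, each of length below 2 s r / 2^N. *)
  move=> e e0; have [N NP] := exists_small_pow (4 * (s * r)) e0.
  exists N => m n Nm Nn.
  have [_ [l jl ll]] := chain N (m - N)%N; have [[l' jl' ll'] _] := chain N (n - N)%N.
  rewrite subnKC// in jl ll; rewrite subnKC// in jl' ll'.
  apply: riem_dist_lt (joined_trans jl jl') _.
  apply: le_lt_trans (leeD ll ll') _; rewrite -EFinD lte_fin.
  have := NP N (leqnn N).
  have h1 : 0 < 2 * (s * r) / 2 ^+ m by rewrite divr_gt0 ?mulr_gt0 ?exprn_gt0.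
  have h2 : 0 < 2 * (s * r) / 2 ^+ n by rewrite divr_gt0 ?mulr_gt0 ?exprn_gt0.
  lra.
have [_ [rho rho0 [h hs]]] := local_diffeo sK K0 q.
(* These choices place the ball of radius rho / 2 about [K (u n)] inside the ball of radius rho
   about [K q], and make r / 2^n less than rho / 2. *)
have [N1 N1P] := uq (s * (rho / 2)) (mulr_gt0 s0 (divr_gt0 rho0 (ltr0Sn _ 1))).
have [N2 N2P] := exists_small_pow r (divr_gt0 rho0 (ltr0Sn _ 1)).
pose n := maxn N1 N2.
have : (riem_dist g (u n) q < (s * (rho / 2))%:E)%E by apply: N1P; exact: leq_maxl.
move=> /ereal_inf_lt [l jl ll].
have llr : (l < (s * rho)%:E)%E.
  by apply: lt_trans ll _; rewrite lte_fin ltr_pM2l//; lra.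
(* The section at the limit [q] passes through [u n], so it restricts to a section that [nAu]
   excludes. *)
have [hu du] := joined_in_section sK K0 s0 gK hs jl llr.
have Ku : `|K (u n) - K q| < rho / 2.
  by rewrite -(ltr_pM2l s0) -lte_fin; exact: le_lt_trans ll.
apply: (nAu n); exists h.
apply: (@section_onW _ (rho / 2)); first by apply: ltW; apply: N2P; exact: leq_maxr.
split => // z zr; have [_ hP] := hs; apply: hP.
rewrite (le_lt_trans (ler_distD (K (u n)) _ _))//; lra.
Qed.

(** All sections through a fixed [p] agree on common balls, so they glue to a section over the whole
    plane, smooth by [lift_smooth]. *)
Theorem complete_local_isometry : exists H : R * R -> S,
  [/\ cancel H K, cancel K H & smooth_param H].
Proof.
have [p _] := surface_nonempty S.
have : forall r : R, exists h, 0 < r -> section_on K p r h.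
  move=> r; have [r0|r0] := ltP 0 r.
    by have [h hP] := all_sections p r0; exists h.
  by exists (fun=> p).
move=> /choice [sec secP].
(* The [+ 1] makes the radius positive and puts [y] strictly inside its ball. *)
pose rad (y : R * R) := `|y - K p| + 1.
have rad0 y : 0 < rad y by rewrite ltr_wpDl.
have radP y : `|y - K p| < rad y by rewrite ltrDl.
pose H y := sec (rad y) y.
have HP y : K (H y) = y /\ {for y, continuous H}.
  have [secp secyP] := secP (rad y) (rad0 y).
  have [Ky cy] := secyP y (radP y); split => //.
  suff E : {near y, sec (rad y) =1 H}.
    suff : H @ y --> H y by [].
    by apply: cvg_trans cy; exact: near_eq_cvg.
  have : \forall x \near y, `|x - K p| < rad y.
    exact: (open_nbhs_nbhs (conj (@open_dist_ball R (K p) (rad y)) (radP y))).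
  apply: filterS => x xr.
  have [secp' secxP] := secP (rad x) (rad0 x).
  have self t : 0 < t -> `|K p - K p| < t by rewrite subrr normr0.
  apply: (section_unique sK K0 secyP secxP (self _ (rad0 y)) (self _ (rad0 x))) => //.
  by rewrite secp secp'.
have Hp : H (K p) = p by have [] := secP (rad (K p)) (rad0 _).
(* [H \o K] and the identity are lifts of [K] that agree at [p], and the surface is connected. *)
have HK q : H (K q) = q.
  apply: (lift_unique sK K0 (x0 := p) (f := H \o K) (g := id)
    (@surface_connected R S)) => // x _.
  have [KH cH] := HP (K x); split.
  - by apply: continuous_comp => //; exact: smooth_fun_continuous.
  - exact: cvg_id.
  - by rewrite /= KH.
exists H; split => //; first by move=> y; have [] := HP y.
split; first by move=> y; have [] := HP y.
move=> a aa k; have [_ C] := lift_smooth sK K0 openT (fun z _ => HP z) aa.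
by apply: Ck_on_sub (C k) => z.
Qed.

End GlobalSection.

(** * Pulling back to the plane *)

Local Open Scope complex_scope.

Section Pullback.
Context {R : realType}.

Lemma ofC_toC (y : R * R) : ofC (toC y) = y.
Proof. by case: y. Qed.

Lemma toC_ofC (z : R[i]) : toC (ofC z) = z.
Proof. by case: z. Qed.

(** Along the ray through [y], subtracting t^2 A / 2 + t B from [f] leaves a function of zero
    derivative, constant by the mean value theorem. *)
Lemma affine_primitive (f : R * R -> R) (df : R * R -> R * R -> R) (y : R * R) (A B : R) :
  (forall z, is_diff z f (df z)) -> (forall t : R, df (t *: y) y = t * A + B) ->
  f y = f 0 + (A / 2 + B).
Proof.
move=> fD dfE.
pose h (t : R) := f (0 + t *: y) - (t * t * (A / 2) + t * B).
have hD (t : R) : is_derive t 1 h 0.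
  have D1 : is_derive t 1 (fun t : R => f (0 + t *: y)) (t * A + B).
    rewrite -dfE -[X in df X](add0r (t *: y)).
    have [d E] := fD (0 + t *: y).
    by rewrite -E -deriveE//; exact: is_derive_segment.
  have D2 : is_derive t 1 (fun t : R => t * t * (A / 2) + t * B) (t * A + B).
    apply: is_derive_eq; rewrite -![_ *: (_ : R)]/(_ * _); lra.
  by rewrite -(subrr (t * A + B)); exact: is_deriveB.
have ch : {within `[0%R, 1%R], continuous h}.
  by apply: derivable_within_continuous => t _; have [] := hD t.
have [c _] := @MVT_segment R h (fun=> 0) 0 1 ler01 (fun t _ => hD t) ch.
rewrite mul0r /h scale1r scale0r !add0r !mul0r !mul1r add0r subr0; lra.
Qed.

Context (S : orientedSurface R).

Lemma tdiff_pair (V W : normedModType R) (f : S -> V) (h : S -> W) p v :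
  smooth_fun f -> smooth_fun h ->
  tdiff (fun q => (f q, h q)) p v = (tdiff f p v, tdiff h p v).
Proof.
move=> /(smooth_fun_differentiable p) df /(smooth_fun_differentiable p) dh.
by have /(congr1 (fun k => k v)) := diff_pair df dh.
Qed.

Lemma tdiff_lin2 (f h : S -> R) (a b : R) p v :
  smooth_fun f -> smooth_fun h ->
  tdiff (fun q => a * f q + b * h q) p v = a * tdiff f p v + b * tdiff h p v.
Proof.
move=> /(smooth_fun_differentiable p)/differentiableP df.
move=> /(smooth_fun_differentiable p)/differentiableP dh.
have [_ E] := is_diffD (is_diffZ a df) (is_diffZ b dh).
by rewrite /tdiff -[RHS]/((a *: _ + b *: _) v) -E.
Qed.

Lemma smooth_pair (V W : normedModType R) (f : S -> V) (h : S -> W) :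
  smooth_fun f -> smooth_fun h -> smooth_fun (fun q => (f q, h q)).
Proof.
move=> sf sh a aa k; have oU := @open_chart_img R S a.
exact: (Ck_on_pair oU (sf a aa k) (sh a aa k)).
Qed.

Lemma smooth_fst (V W : normedModType R) (f : S -> V * W) :
  smooth_fun f -> smooth_fun (fun q => (f q).1).
Proof.
move=> sf a aa k; have oU := @open_chart_img R S a.
exact: (Ck_on_fst oU (sf a aa k)).
Qed.

Lemma smooth_snd (V W : normedModType R) (f : S -> V * W) :
  smooth_fun f -> smooth_fun (fun q => (f q).2).
Proof.
move=> sf a aa k; have oU := @open_chart_img R S a.
exact: (Ck_on_snd oU (sf a aa k)).
Qed.

Lemma smooth_lin2 (f h : S -> R) (a b : R) :
  smooth_fun f -> smooth_fun h -> smooth_fun (fun q => a * f q + b * h q).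
Proof.
move=> sf sh c ac k; have oU := @open_chart_img R S c.
exact: (Ck_onD oU (Ck_onZ a oU (sf c ac k)) (Ck_onZ b oU (sh c ac k))).
Qed.

Lemma tdiff_fst (V W : normedModType R) (f : S -> V * W) p v :
  smooth_fun f -> tdiff (fun q => (f q).1) p v = (tdiff f p v).1.
Proof.
move=> sf; have {2}-> : f = (fun q => ((f q).1, (f q).2)).
  by apply/funext => q; exact: surjective_pairing.
by rewrite tdiff_pair//; [exact: smooth_fst|exact: smooth_snd].
Qed.

Lemma tdiff_snd (V W : normedModType R) (f : S -> V * W) p v :
  smooth_fun f -> tdiff (fun q => (f q).2) p v = (tdiff f p v).2.
Proof.
move=> sf; have {2}-> : f = (fun q => ((f q).1, (f q).2)).
  by apply/funext => q; exact: surjective_pairing.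
by rewrite tdiff_pair//; [exact: smooth_fst|exact: smooth_snd].
Qed.

(** [tau] is the differential of [H] in the chart at [H y]. Differentiating [K \o H = id] shows that
    [tdiff K] undoes it, and the same [tau] serves every [f]. *)
Lemma pullback (K : S -> R * R) (H : R * R -> S) (y : R * R) :
  smooth_fun K -> cancel H K -> smooth_param H ->
  exists tau : R * R -> R * R,
    (forall w, tdiff K (H y) (tau w) = w) /\
    forall (W : normedModType R) (f : S -> W), smooth_fun f ->
      is_diff y (f \o H) (tdiff f (H y) \o tau).
Proof.
move=> sK HK [cH sH].
have [ab bp] := chart_atP (H y).
have dH : differentiable (chart_map (chart_at (H y)) \o H) y.
  by apply: Ck_on_diff (sH _ ab 1%N) _.
exists ('d (chart_map (chart_at (H y)) \o H) y).
have fD (W : normedModType R) (f : S -> W) : smooth_fun f ->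
    is_diff y (f \o H) (tdiff f (H y) \o 'd (chart_map (chart_at (H y)) \o H) y).
  move=> sf; apply: tdiff_comp => //; first exact: cH.
  exact: smooth_fun_differentiable.
split => // w.
have := fD _ K sK; have -> : K \o H = id by apply/funext.
move=> [_ E]; have [_ E'] := is_diff_id y.
by have := congr1 (fun h => h w) (etrans (esym E) E').
Qed.


End Pullback.

(** * Weierstrass data *)

Section ComplexCoordinates.
Context {R : realType}.

Lemma complex_half (a b : R) : (a +i* b) / 2 = (2^-1 * a) +i* (2^-1 * b).
Proof.
have n2 : (2 : R[i]) != 0 by rewrite pnatr_eq0.
apply: (mulIf n2); rewrite divfK// mulr_natr mulr2n.
by apply/eqP; rewrite eq_complex /=; apply/andP; split; apply/eqP; field.
Qed.

Lemma dot2_ofC_mul (c z w : R[i]) :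
  dot2 (ofC (c * z)) (ofC (c * w)) =
  ComplexField.Normc.normc c ^+ 2 * dot2 (ofC z) (ofC w).
Proof.
case: c z w => [c1 c2] [z1 z2] [w1 w2].
rewrite /dot2 /= sqr_sqrtr ?addr_ge0 ?sqr_ge0//; ring.
Qed.

Lemma det2_ofC_mul (c z w : R[i]) :
  det2 (ofC (c * z)) (ofC (c * w)) =
  ComplexField.Normc.normc c ^+ 2 * det2 (ofC z) (ofC w).
Proof.
case: c z w => [c1 c2] [z1 z2] [w1 w2].
rewrite /det2 /= sqr_sqrtr ?addr_ge0 ?sqr_ge0//; ring.
Qed.

Lemma wedge0_ratio (F : fieldType) (gu gv fu fv : F) :
  gu != 0 -> gu * fv = gv * fu -> fv = fu / gu * gv.
Proof. by move=> gu0 E; apply: (mulfI gu0); rewrite E; field. Qed.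

End ComplexCoordinates.

(** * The special Lagrangian equations in Weierstrass data *)

Section Front.
Context {R : realType} (S : orientedSurface R) (psi : improper_affine_front S).

Definition lift_x1 (p : S) : R := complex.Re (front_lift psi p).1.
Definition lift_n1 (p : S) : R := complex.Im (front_lift psi p).1.
Definition lift_x2 (p : S) : R := complex.Re (front_lift psi p).2.
Definition lift_n2 (p : S) : R := complex.Im (front_lift psi p).2.

Local Notation x1 := lift_x1.
Local Notation n1 := lift_n1.
Local Notation x2 := lift_x2.
Local Notation n2 := lift_n2.

Lemma front_smooth : [/\ smooth_fun x1, smooth_fun n1, smooth_fun x2 & smooth_fun n2].
Proof.
have [[s1 s2 _] _ _ _] := front_lift_slag psi.
by split; [exact: smooth_fst s1|exact: smooth_snd s1|
  exact: smooth_fst s2|exact: smooth_snd s2].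
Qed.

Local Notation X1 := (tdiff x1).
Local Notation X2 := (tdiff x2).
Local Notation N1 := (tdiff n1).
Local Notation N2 := (tdiff n2).

Lemma ctdiff_lift p v :
  ctdiff2 (front_lift psi) p v = (X1 p v +i* N1 p v, X2 p v +i* N2 p v).
Proof.
have [sx1 sn1 sx2 sn2] := front_smooth.
rewrite /ctdiff2 /ctdiff.
have -> : ofC \o (fun q => (front_lift psi q).1) = (fun q => (x1 q, n1 q)) by [].
have -> : ofC \o (fun q => (front_lift psi q).2) = (fun q => (x2 q, n2 q)) by [].
by rewrite !tdiff_pair.
Qed.

Lemma lagrangian_relation p u v :
  X1 p u * N1 p v - N1 p u * X1 p v + (X2 p u * N2 p v - N2 p u * X2 p v) = 0.
Proof.
have [_ /(_ p u v) + _ _] := front_lift_slag psi.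
rewrite !ctdiff_lift /omega' /= => /eqP; rewrite mulf_eq0.
have i0 : ('i / 2 : R[i]) != 0.
  rewrite mulf_neq0 ?invr_eq0 ?pnatr_eq0//.
  by rewrite eq_complex /= oner_eq0 andbF.
rewrite (negPf i0) /= eq_complex /= => /andP[_ /eqP].
move: (X1 p u) (X2 p u) (N1 p u) (N2 p u)
  (X1 p v) (X2 p v) (N1 p v) (N2 p v) => a b c d a' b' c' d'.
lra.
Qed.

(** Im (i z) = Re z, so this is the vanishing of the real part of [Omega']. *)
Lemma special_relation p u v :
  X1 p u * X2 p v - N1 p u * N2 p v - (X1 p v * X2 p u - N1 p v * N2 p u) = 0.
Proof.
have [_ _ /(_ p u v) + _] := front_lift_slag psi.
rewrite !ctdiff_lift /Omega' /=.
move: (X1 p u) (X2 p u) (N1 p u) (N2 p u)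
  (X1 p v) (X2 p v) (N1 p v) (N2 p v) => a b c d a' b' c' d'.
lra.
Qed.

Lemma special_orientation p :
  0 < N1 p (0, 1) * X2 p (1, 0) + X1 p (0, 1) * N2 p (1, 0)
      - (X1 p (1, 0) * N2 p (0, 1) + N1 p (1, 0) * X2 p (0, 1)).
Proof.
have [_ _ _ /(_ p)] := front_lift_slag psi.
rewrite !ctdiff_lift /Omega' /=.
move: (X1 p (1, 0)) (X2 p (1, 0)) (N1 p (1, 0)) (N2 p (1, 0))
  (X1 p (0, 1)) (X2 p (0, 1)) (N1 p (0, 1)) (N2 p (0, 1)) => a b c d a' b' c' d'.
lra.
Qed.

Lemma weierG_coord : ofC \o weierG psi =
  (fun q => (2^-1 * x1 q + - 2^-1 * n1 q, 2^-1 * x2 q + - 2^-1 * n2 q)).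
Proof.
apply/funext => q.
rewrite [LHS]/(ofC (((x1 q - n1 q) +i* (x2 q - n2 q)) / 2)).
rewrite complex_half /ofC /=.
by move: (x1 q) (x2 q) (n1 q) (n2 q) => a b c d; apply/pair_equal_spec; split; ring.
Qed.

Lemma weierF_coord : ofC \o weierF psi =
  (fun q => (2^-1 * x1 q + 2^-1 * n1 q, - 2^-1 * x2 q + - 2^-1 * n2 q)).
Proof.
apply/funext => q.
rewrite [LHS]/(ofC (conjc (((x1 q + n1 q) +i* (x2 q + n2 q)) / 2))).
rewrite complex_half /ofC /=.
by move: (x1 q) (x2 q) (n1 q) (n2 q) => a b c d; apply/pair_equal_spec; split; ring.
Qed.

Lemma weier_smooth : smooth_cfun (weierF psi) /\ smooth_cfun (weierG psi).
Proof.
have [sx1 sn1 sx2 sn2] := front_smooth.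
rewrite /smooth_cfun weierF_coord weierG_coord.
by split; apply: smooth_pair; exact: smooth_lin2.
Qed.

Lemma tdiff_weierG p v : tdiff (ofC \o weierG psi) p v =
  (2^-1 * X1 p v + - 2^-1 * N1 p v, 2^-1 * X2 p v + - 2^-1 * N2 p v).
Proof.
have [sx1 sn1 sx2 sn2] := front_smooth.
rewrite weierG_coord tdiff_pair; [|exact: smooth_lin2|exact: smooth_lin2].
by rewrite !tdiff_lin2.
Qed.

Lemma tdiff_weierF p v : tdiff (ofC \o weierF psi) p v =
  (2^-1 * X1 p v + 2^-1 * N1 p v, - 2^-1 * X2 p v + - 2^-1 * N2 p v).
Proof.
have [sx1 sn1 sx2 sn2] := front_smooth.
rewrite weierF_coord tdiff_pair; [|exact: smooth_lin2|exact: smooth_lin2].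
by rewrite !tdiff_lin2.
Qed.

(* The two Lagrangian conditions are the real and imaginary parts of dG /\ dF = 0. *)
Lemma weier_wedge p u v :
  ctdiff (weierG psi) p u * ctdiff (weierF psi) p v =
  ctdiff (weierG psi) p v * ctdiff (weierF psi) p u.
Proof.
rewrite /ctdiff !tdiff_weierF !tdiff_weierG.
move: (lagrangian_relation p u v) (special_relation p u v).
move: (X1 p u) (X2 p u) (N1 p u) (N2 p u)
  (X1 p v) (X2 p v) (N1 p v) (N2 p v) => a b c d a' b' c' d'.
by move=> A1 A2; apply/eqP; rewrite eq_complex /=; apply/andP; split; apply/eqP; lra.
Qed.

(** Polarised parallelogram identity for x = G + conj F and n = conj F - G. *)
Lemma dtau2_weier p u v : dtau2 psi p u v =
  2 * (dot2 (tdiff (ofC \o weierG psi) p u) (tdiff (ofC \o weierG psi) p v) +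
       dot2 (tdiff (ofC \o weierF psi) p u) (tdiff (ofC \o weierF psi) p v)).
Proof.
have [sx1 sn1 sx2 sn2] := front_smooth.
rewrite !tdiff_weierF !tdiff_weierG /dtau2.
have -> : fx psi = (fun q => (x1 q, x2 q)) by [].
have -> : fn psi = (fun q => (n1 q, n2 q)) by [].
rewrite !tdiff_pair// /dot2 /=.
move: (X1 p u) (X2 p u) (N1 p u) (N2 p u)
  (X1 p v) (X2 p v) (N1 p v) (N2 p v) => a b c d a' b' c' d'.
by field.
Qed.

(** The sum is half of the expression in [special_orientation]. *)
Lemma weier_det p :
  0 < det2 (tdiff (ofC \o weierG psi) p (1, 0)) (tdiff (ofC \o weierG psi) p (0, 1)) +
      det2 (tdiff (ofC \o weierF psi) p (1, 0)) (tdiff (ofC \o weierF psi) p (0, 1)).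
Proof.
have := special_orientation p; rewrite !tdiff_weierF !tdiff_weierG /det2 /=.
move: (X1 p (1, 0)) (X2 p (1, 0)) (N1 p (1, 0)) (N2 p (1, 0))
  (X1 p (0, 1)) (X2 p (0, 1)) (N1 p (0, 1)) (N2 p (0, 1)) => a b c d a' b' c' d'.
lra.
Qed.

(** The finite value is picked by [xget], so some scalar with dF = l dG must first be exhibited;
    [weier_wedge] supplies the quotient at a vector where dG is nonzero. *)
Lemma constant_gauss_map :
  (exists w, forall p, lagrangian_gauss_map psi p = w) ->
  (forall p v, ctdiff (weierG psi) p v = 0) \/
  exists c, forall p v, ctdiff (weierF psi) p v = c * ctdiff (weierG psi) p v.
Proof.
move=> [[c|] nuw]; [right; exists c|left] => p; last first.
  by have := nuw p; rewrite /lagrangian_gauss_map; case: asboolP.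
have := nuw p; rewrite /lagrangian_gauss_map; case: asboolP => // nG [<-].
move: nG => /existsNP [u /eqP Gu].
have ex : [set l | forall v, ctdiff (weierF psi) p v = l * ctdiff (weierG psi) p v]
    (ctdiff (weierF psi) p u / ctdiff (weierG psi) p u).
  by move=> v; apply: (wedge0_ratio Gu); exact: weier_wedge.
exact: (xgetPex 0 (ex_intro _ _ ex)).
Qed.

Lemma weier_inv p : [/\ x1 p = (ofC (weierG psi p)).1 + (ofC (weierF psi p)).1,
  x2 p = (ofC (weierG psi p)).2 - (ofC (weierF psi p)).2,
  n1 p = (ofC (weierF psi p)).1 - (ofC (weierG psi p)).1 &
  n2 p = - (ofC (weierF psi p)).2 - (ofC (weierG psi p)).2].
Proof.
have EG : ofC (weierG psi p) = _ := congr1 (fun h => h p) weierG_coord.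
have EF : ofC (weierF psi p) = _ := congr1 (fun h => h p) weierF_coord.
rewrite EG EF.
by rewrite /=; move: (x1 p) (x2 p) (n1 p) (n2 p) => a b c d; split; field.
Qed.

Lemma tdiff_weier_inv p v :
  X1 p v = (tdiff (ofC \o weierG psi) p v).1 + (tdiff (ofC \o weierF psi) p v).1 /\
  X2 p v = (tdiff (ofC \o weierG psi) p v).2 - (tdiff (ofC \o weierF psi) p v).2.
Proof.
rewrite tdiff_weierF tdiff_weierG /=.
by move: (X1 p v) (X2 p v) (N1 p v) (N2 p v) => a b c d; split; field.
Qed.

Lemma tdiff_phi p v : tdiff (fun q => (psi q).2) p v =
  - (n1 p * X1 p v + n2 p * X2 p v).
Proof.
have [sx1 sn1 sx2 sn2] := front_smooth.
rewrite front_phi.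
have -> : (fun q => (psi q).1) = (fun q => (x1 q, x2 q)).
  by apply/funext => q; rewrite front_x.
by rewrite tdiff_pair.
Qed.

(* Completeness makes [K] a global chart; in it [M] has the constant derivative [c]. *)
Lemma weakly_complete_chart (K M : S -> R[i]) (c : R[i]) :
  weakly_complete psi -> smooth_cfun K -> smooth_cfun M ->
  (forall p v, ctdiff M p v = c * ctdiff K p v) ->
  (forall p u v, dtau2 psi p u v =
     2 * (dot2 (tdiff (ofC \o K) p u) (tdiff (ofC \o K) p v) +
          dot2 (tdiff (ofC \o M) p u) (tdiff (ofC \o M) p v))) ->
  (forall p, 0 < det2 (tdiff (ofC \o K) p (1, 0)) (tdiff (ofC \o K) p (0, 1)) +
                 det2 (tdiff (ofC \o M) p (1, 0)) (tdiff (ofC \o M) p (0, 1))) ->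
  exists H : R * R -> S, exists d : R[i],
    [/\ biholomorphic_to_C psi K, cancel H (ofC \o K), cancel (ofC \o K) H,
        smooth_param H & forall p, M p = c * K p + d].
Proof.
move=> gc sK sM MK gKM detKM.
set N := ComplexField.Normc.normc c ^+ 2.
have N0 : 0 <= N by exact: sqr_ge0.
have tM p v : tdiff (ofC \o M) p v = ofC (c * toC (tdiff (ofC \o K) p v)).
  by rewrite -[LHS]ofC_toC; congr ofC; exact: MK.
have gE p u v : dtau2 psi p u v =
    2 * (1 + N) * dot2 (tdiff (ofC \o K) p u) (tdiff (ofC \o K) p v).
  by rewrite gKM !tM dot2_ofC_mul !ofC_toC -/N; ring.
(* Multiplication by [c] scales determinants by N >= 0, so the sum is 1 + N times the determinant of
   [K], which inherits its sign. *)
have detE p : 0 < det2 (tdiff (ofC \o K) p (1, 0)) (tdiff (ofC \o K) p (0, 1)).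
  have := detKM p; rewrite !tM det2_ofC_mul !ofC_toC -/N.
  set D := det2 _ _; have -> : D + N * D = (1 + N) * D by ring.
  by rewrite pmulr_rgt0// ltr_pwDl.
have l0 : 0 < 2 * (1 + N) by rewrite mulr_gt0// ltr_pwDl.
(* The homothety ratio of [K]. *)
have s0 : 0 < Num.sqrt (2 * (1 + N)) by rewrite sqrtr_gt0.
have gK p u : dtau2 psi p u u = Num.sqrt (2 * (1 + N)) ^+ 2 *
    dot2 (tdiff (ofC \o K) p u) (tdiff (ofC \o K) p u).
  by rewrite gE sqr_sqrtr// ltW.
have [H [HK KH sH]] := complete_local_isometry sK detE s0 gK gc.
exists H, (M (H 0)); split => //.
- split => //.
  + exists (H \o ofC); split.
    * by move=> p; exact: KH.
    * by move=> z; rewrite -[RHS]toC_ofC -[in RHS](HK (ofC z)) /= toC_ofC.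
    * suff -> : (H \o ofC) \o toC = H by [].
      by apply/funext => y; rewrite /= ofC_toC.
  + move=> p; exists (2 * (1 + N))^-1; first by rewrite invr_gt0.
    by move=> u v; rewrite /ctdiff !ofC_toC gE mulKf// gt_eqF.
- move=> p; rewrite -[p in LHS]KH.
  have s1 := smooth_fst sM; have s2 := smooth_snd sM.
  (* In the chart [H] the differential of [M] is multiplication by [c] everywhere, so each
     coordinate is integrated along rays with zero slope term. *)
  have D1 (z : R * R) : is_diff z (fun y => (ofC (M (H y))).1) (fun w => (ofC (c * toC w)).1).
    have [tau [tauK tauP]] := pullback z sK HK sH.
    have := tauP _ _ s1; congr is_diff_def; apply/funext => w.
    by rewrite [LHS](tdiff_fst (H z) (tau w) sM) tM tauK.
  have D2 (z : R * R) : is_diff z (fun y => (ofC (M (H y))).2) (fun w => (ofC (c * toC w)).2).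
    have [tau [tauK tauP]] := pullback z sK HK sH.
    have := tauP _ _ s2; congr is_diff_def; apply/funext => w.
    by rewrite [LHS](tdiff_snd (H z) (tau w) sM) tM tauK.
  set y := (ofC \o K) p.
  have E1 := @affine_primitive _ _ _ y 0 (ofC (c * toC y)).1 D1.
  have E2 := @affine_primitive _ _ _ y 0 (ofC (c * toC y)).2 D2.
  have {}E1 : (ofC (M (H y))).1 = (ofC (M (H 0))).1 + (0 / 2 + (ofC (c * toC y)).1).
    by apply: E1 => t; rewrite mulr0 add0r.
  have {}E2 : (ofC (M (H y))).2 = (ofC (M (H 0))).2 + (0 / 2 + (ofC (c * toC y)).2).
    by apply: E2 => t; rewrite mulr0 add0r.
  rewrite mul0r !add0r in E1 E2.
  have Ey : toC y = K p by exact: toC_ofC.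
  rewrite Ey in E1 E2; apply/eqP; rewrite eq_complex; apply/andP; split; apply/eqP.
    by rewrite addrC raddfD; exact: E1.
  by rewrite addrC raddfD; exact: E2.
Qed.

End Front.

(** * Linear parts of the affine maps from the model to the front *)

Section Shear.
Context {R : realType}.

(** The sign [e] reflects the second coordinate and the height together; [a] and [b] absorb the
    linear height terms produced by integration constants. *)
Definition shear (e a b : R) (v : R * R * R) : R * R * R :=
  ((v.1.1, e * v.1.2), e * v.2 + a * v.1.1 + b * v.1.2).

Lemma shear_linear e a b : linear (shear e a b).
Proof.
move=> k [[u1 u2] u3] [[v1 v2] v3]; rewrite /shear /=.
by apply/pair_equal_spec; split; [apply/pair_equal_spec; split|];
  rewrite /= -![_ *: (_ : R)]/(_ * _); ring.
Qed.

HB.instance Definition _ e a b :=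
  GRing.isLinear.Build R (R * R * R)%type (R * R * R)%type *:%R (shear e a b)
    (shear_linear e a b).

Lemma shear_bij e a b : e * e = 1 -> bijective (shear e a b).
Proof.
move=> ee; exists (shear e (- e * a) (- b)) => -[[u1 u2] u3]; rewrite /shear /=.
  have E (x : R) : e * (e * x) = x by rewrite mulrA ee mul1r.
  by congr (_, _, _); rewrite ?E // !mulrDr !E; ring.
congr (_, _, _); first by rewrite mulrA ee mul1r.
by transitivity (e * e * (u3 - a * u1) + a * u1); [ring|rewrite ee; ring].
Qed.

End Shear.

(** * Classification *)

Section Classification.
Context {R : realType} (S : orientedSurface R) (psi : improper_affine_front S).

(* In the chart [K] the lift is affine, so the height is the integral of an affine
   one-form along the segment from the origin. *)
Lemma height_in_chart (K : S -> R * R) (H : R * R -> S)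
    (n : R * R -> R * R) (X : R * R -> R * R) (y : R * R) (A B : R) :
  smooth_fun K -> cancel H K -> smooth_param H ->
  (forall z, n z = (lift_n1 psi (H z), lift_n2 psi (H z))) ->
  (forall p v, X (tdiff K p v) = (tdiff (lift_x1 psi) p v, tdiff (lift_x2 psi) p v)) ->
  (forall t : R, - dot2 (n (t *: y)) (X y) = t * A + B) ->
  (psi (H y)).2 = (psi (H 0)).2 + (A / 2 + B).
Proof.
move=> sK HK sH nE XE AB.
apply: (@affine_primitive _ (fun y => (psi (H y)).2) (fun z w => - dot2 (n z) (X w))) => //.
move=> z; have [tau [tauK tauP]] := pullback z sK HK sH.
have := tauP _ _ (front_phi_smooth psi); congr is_diff_def; apply/funext => w.
rewrite [LHS](tdiff_phi psi (H z) (tau w)) nE.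
by have := XE (H z) (tau w); rewrite tauK => ->.
Qed.

Lemma normc_sqr (a b : R) : ComplexField.Normc.normc (a +i* b) ^+ 2 = a ^+ 2 + b ^+ 2.
Proof. by rewrite /= sqr_sqrtr// addr_ge0 ?sqr_ge0. Qed.

Lemma front_eq p (a b h : R) : lift_x1 psi p = a -> lift_x2 psi p = b -> (psi p).2 = h ->
  psi p = ((a, b), h).
Proof.
move=> <- <- <-; rewrite [LHS]surjective_pairing front_x.
by [].
Qed.

Lemma paraboloid_of_finite_gauss_map c : weakly_complete psi ->
  (forall p v, ctdiff (weierF psi) p v = c * ctdiff (weierG psi) p v) ->
  elliptic_paraboloid psi.
Proof.
move=> wc FG; have [sF sG] := weier_smooth psi.
have [H [d [bih HK KH sH Fd]]] := weakly_complete_chart wc sG sF FG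
  (dtau2_weier psi) (weier_det psi).
case: c FG Fd => [c1 c2] FG Fd; case: d Fd => [d1 d2] Fd.
(* Here F = c G + d, so x is the model shifted by conj d. The constant part conj d of n adds minus
   its inner product with the model's horizontal part to the height, whence the coefficients - d1
   and d2. *)
exists (c1 +i* c2), (weierG psi), (shear 1 (- d1) d2), ((d1, - d2), (psi (H 0)).2).
split => //; first by apply: shear_bij; rewrite mulr1.
move=> p; have [] := weier_inv psi p; rewrite Fd.
set y := ofC (weierG psi p); have yE : weierG psi p = y.1 +i* y.2.
  by rewrite /y; case: (weierG psi p).
rewrite yE /= => x1E x2E _ _.
have lift z : weierG psi (H z) = z.1 +i* z.2.
  by have := congr1 toC (HK z); rewrite /= toC_ofC.
(* Along the ray through [y] the integrand of the height is t A + B: [A] yields the quadratic part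
   and [B] the linear part. *)
pose A := (1 - (c1 ^+ 2 + c2 ^+ 2)) * (y.1 ^+ 2 + y.2 ^+ 2).
pose B := - d1 * (y.1 + (c1 * y.1 - c2 * y.2)) + d2 * (y.2 - (c1 * y.2 + c2 * y.1)).
have hE : (psi p).2 = (psi (H 0)).2 + (A / 2 + B).
  have <- : H y = p by exact: KH.
  apply: (height_in_chart sG HK sH
    (n := fun z => ((c1 * z.1 - c2 * z.2 + d1) - z.1, - (c1 * z.2 + c2 * z.1 + d2) - z.2))
    (X := fun w => (w.1 + (c1 * w.1 - c2 * w.2), w.2 - (c1 * w.2 + c2 * w.1)))).
  - move=> z; have [_ _ -> ->] := weier_inv psi (H z).
    by rewrite Fd lift.
  - move=> q v; have [-> ->] := tdiff_weier_inv psi q v.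
    have FGv : tdiff (ofC \o weierF psi) q v =
        ofC ((c1 +i* c2) * toC (tdiff (ofC \o weierG psi) q v)).
      by rewrite -[LHS]ofC_toC; congr ofC; exact: FG.
    by rewrite FGv.
  - move=> t; rewrite /A /B /dot2 /= -![_ *: (_ : R)]/(_ * _).
    move: y.1 y.2 => u v; ring.
rewrite (front_eq x1E x2E hE) /A /B /model_paraboloid !normc_sqr /shear /=.
move: y.1 y.2 => u v.
by apply/pair_equal_spec; split; [apply/pair_equal_spec; split|]; rewrite /=; field.
Qed.

(** [F] and [G] exchange roles: [F] is the global chart and [G] is constant, the ratio being 0. *)
Lemma paraboloid_of_infinite_gauss_map : weakly_complete psi ->
  (forall p v, ctdiff (weierG psi) p v = 0) -> elliptic_paraboloid psi.
Proof.
move=> wc G0; have [sF sG] := weier_smooth psi.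
have GF p v : ctdiff (weierG psi) p v = 0 * ctdiff (weierF psi) p v by rewrite mul0r.
have gE p u v := etrans (dtau2_weier psi p u v) (congr1 ( *%R 2) (addrC _ _)).
have detE p : 0 <
    det2 (tdiff (ofC \o weierF psi) p (1, 0)) (tdiff (ofC \o weierF psi) p (0, 1)) +
    det2 (tdiff (ofC \o weierG psi) p (1, 0)) (tdiff (ofC \o weierG psi) p (0, 1)).
  by rewrite addrC; exact: weier_det.
have [H [d [bih HK KH sH Gd]]] := weakly_complete_chart wc sF sG GF gE detE.
case: d Gd => [d1 d2] Gd.
(* Now x = conj F + d and n = conj F - d: the conjugation reflects the second coordinate, and the
   height - |F|^2 / 2 + d1 y.1 - d2 y.2 is opposite in sign to the model with c = 0, hence e =
   -1. *)
exists 0, (weierF psi), (shear (-1) d1 (- d2)), ((d1, d2), (psi (H 0)).2).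
split => //; first by apply: shear_bij; rewrite mulrNN mulr1.
move=> p; have [] := weier_inv psi p; rewrite Gd mul0r add0r.
set y := ofC (weierF psi p); have yE : weierF psi p = y.1 +i* y.2.
  by rewrite /y; case: (weierF psi p).
move=> x1E x2E _ _.
have lift z : weierF psi (H z) = z.1 +i* z.2.
  by have := congr1 toC (HK z); rewrite /= toC_ofC.
pose A := - (y.1 ^+ 2 + y.2 ^+ 2); pose B := d1 * y.1 - d2 * y.2.
have hE : (psi p).2 = (psi (H 0)).2 + (A / 2 + B).
  have <- : H y = p by exact: KH.
  apply: (height_in_chart sF HK sH
    (n := fun z => (z.1 - d1, - z.2 - d2)) (X := fun w => (w.1, - w.2))).
  - move=> z; have [_ _ -> ->] := weier_inv psi (H z).
    by rewrite Gd lift mul0r add0r.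
  - move=> q v; have [-> ->] := tdiff_weier_inv psi q v.
    have G0v : tdiff (ofC \o weierG psi) q v = 0.
      by rewrite -[LHS]ofC_toC -[toC _]/(ctdiff (weierG psi) q v) G0.
    by rewrite G0v /= !add0r.
  - move=> t; rewrite /A /B /dot2 /= -![_ *: (_ : R)]/(_ * _).
    move: y.1 y.2 => u v; ring.
rewrite (front_eq x1E x2E hE) /A /B /model_paraboloid.
rewrite -[X in ComplexField.Normc.normc X](_ : 0 +i* 0 = _)//.
rewrite normc_sqr yE normc_sqr conjc0 mul0r addr0 /shear /=.
move: y.1 y.2 => u v.
by apply/pair_equal_spec; split; [apply/pair_equal_spec; split|]; rewrite /=; field.
Qed.

End Classification.

Theorem proposition3p1 (R : realType) (S : orientedSurface R)
  (psi : improper_affine_front S) (psi_complete : weakly_complete psi)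
  (nu_constant : exists w : option (complex R),
     forall p : S, lagrangian_gauss_map psi p = w) :
  elliptic_paraboloid psi.
Proof.
have [G0|[c FG]] := constant_gauss_map nu_constant.
  exact: paraboloid_of_infinite_gauss_map.
exact: paraboloid_of_finite_gauss_map FG.
Qed.
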